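(* $\mathrm{3SATC}\notin\mathbf P_{\mathrm{IS}}$ if and only if $\mathrm{3SAT}\notin\mathrm{P/poly}$.
   Context: Let $\mathbb B=\{\mathsf T,\mathsf F\}$. Instruction sequences: there are Boolean registers named $\mathtt{in}{:}i$, $\mathtt{aux}{:}i$ ($i\ge1$) and $\mathtt{out}$, processing methods $\mathtt{set{:}T}$ (content becomes $\mathsf T$, reply $\mathsf T$), $\mathtt{set{:}F}$ (content becomes $\mathsf F$, reply $\mathsf F$), $\mathtt{get}$ (no change, reply is the content). Basic instructions are $f.m$. Primitive instructions: for each basic instruction $a$, the plain instruction $a$, positive test $+a$, negative test $-a$; forward jumps $\#l$ ($l\in\mathbb N$); termination $!$. An instruction sequence is a finite non-empty sequence $X=u_1;\dots;u_k$ of primitive instructions, $|X|=k$. Execution starts at $u_1$: $a$ executes $a$ and proceeds with the next instruction; $+a$ executes $a$ and proceeds with the next instruction if the reply is $\mathsf T$, otherwise skips the next instruction and proceeds with the one after; $-a$ likewise with reply roles reversed; $\#l$ proceeds with the $l$-th next instruction ($\#0$ causes inaction); $!$ terminates; if there is no instruction to proceed with, inaction occurs. $\mathcal{IS}_{br}$ is the set of instruction sequences whose basic instructions are all of the forms $\mathtt{in}{:}i.\mathtt{get}$, $\mathtt{aux}{:}i.\mathtt{get}$, $\mathtt{aux}{:}i.\mathtt{set{:}}b$, $\mathtt{out}.\mathtt{set{:}}b$. $X$ computes $f:\mathbb B^n\to\mathbb B$ if for all $b_1,\dots,b_n$, executing $X$ with $\mathtt{in}{:}i$ initially $b_i$ ($i\le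 n$) and all auxiliary registers and $\mathtt{out}$ initially $\mathsf F$, execution never executes an instruction on $\mathtt{in}{:}i$ with $i>n$, ends by executing $!$, and leaves $f(b_1,\dots,b_n)$ in $\mathtt{out}$. A Boolean function family is a sequence $(f_n)_{n\in\mathbb N}$ with $f_n:\mathbb B^n\to\mathbb B$, identified with the function $f:\mathbb B^*\to\mathbb B$ with $f(w)=f_n(w)$ for $w\in\mathbb B^n$. $\mathbf P_{\mathrm{IS}}$ is the class of Boolean function families $(f_n)$ for which there is a polynomial $h$ such that for every $n$ some $X\in\mathcal{IS}_{br}$ computes $f_n$ with $|X|\le h(n)$. The family $\mathrm{3SATC}=(\mathrm{3SATC}_n)$: let $\mathrm{nd}(k)=\binom{2k}{1}+\binom{2k}{2}+\binom{2k}{3}$; fix bijections $\alpha_k:[1,\mathrm{nd}(k)]\to\{L\subseteq\{v_1,\neg v_1,\dots,v_k,\neg v_k\}\mid1\le|L|\le3\}$ with $\alpha_i^{-1}(\alpha_{i+1}(j))=j$ for all $i$ and $j\in[1,\mathrm{nd}(i)]$, such that $\alpha(i)=\alpha_{\min\{j\mid i\in[1,\mathrm{nd}(j)]\}}(i)$ is polynomial-time computable; if $n=\mathrm{nd}(k)$ then $\mathrm{3SATC}_n(b_1,\dots,b_n)=\mathsf T$ iff $\bigwedge_{i\in[1,n],\,b_i=\mathsf T}\bigvee\alpha_k(i)$ is satisfiable; if $\mathrm{nd}(k)<n<\mathrm{nd}(k+1)$ then $\mathrm{3SATC}_n(b_1,\dots,b_n)=\mathrm{3SATC}_{\mathrm{nd}(k)}(b_1,\dots,b_{\mathrm{nd}(k)})$.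 $\mathrm{3SAT}$ and $\mathrm{P/poly}$ are the standard notions. *)

(* Defs.v *)
(* MathComp world; from MathComp-Analysis only the classical layer is used. *)
From HB Require Import structures.
From mathcomp Require Import all_boot all_order all_algebra finmap.
From mathcomp Require Import boolp classical_sets functions.
Set Implicit Arguments.
Unset Strict Implicit.
Unset Printing Implicit Defensive.

Local Open Scope nat_scope.

(* A family (f_n) with f_n : B^n -> B is identified with a function B^* -> B.
   Bounding polynomials have natural number coefficients; this loses nothing,
   since every real polynomial is dominated on nat by such a polynomial. *)
Definition bfamily := seq bool -> bool.

(** * Instruction sequences *)

Inductive focus := In of nat | Aux of nat | Out.

Definition focus_eqb (f g : focus) : bool :=
  match f, g with
  | In i, In j => i == j
  | Aux i, Aux j => i == j
  | Out, Out => true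
  | _, _ => false
  end.

(* [Set_ b] is set:b. *)
Inductive method := Set_ of bool | Get.

Inductive basic := Basic of focus & method.

Inductive instr :=
  | Plain of basic
  | PosTest of basic
  | NegTest of basic
  | Jump of nat
  | Term.

(* Register indices start at 1. *)
Definition basic_br (a : basic) : bool :=
  match a with
  | Basic (In i) Get => 0 < i
  | Basic (Aux i) _ => 0 < i
  | Basic Out (Set_ _) => true
  | _ => false
  end.

Definition instr_br (u : instr) : bool :=
  match u with
  | Plain a | PosTest a | NegTest a => basic_br a
  | Jump _ | Term => true
  end.

Definition IS_br (X : seq instr) : bool := (0 < size X) && all instr_br X.

Definition regs := focus -> bool.

Definition new_content (m : method) (c : bool) : bool :=
  if m is Set_ b then b else c.

Definition reply_of (m : method) (c : bool) : bool :=
  if m is Set_ b then b else c.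

Definition effect (a : basic) (s : regs) : regs :=
  let: Basic f m := a in
  fun g => if focus_eqb g f then new_content m (s f) else s g.

Definition reply (a : basic) (s : regs) : bool :=
  let: Basic f m := a in reply_of m (s f).

Definition available (n : nat) (a : basic) : bool :=
  if a is Basic (In i) _ then i <= n else true.

(* [exec n X p s s'] : execution of X from the instruction at (0-based)
   position p in state s reaches Term with final state s', and never executes
   an instruction on in:i with i > n.  Inaction (#0, or no instruction to
   proceed with) and divergence give no derivation. *)
Inductive exec (n : nat) (X : seq instr) : nat -> regs -> regs -> Prop :=
  | exec_plain p a s s' :
      onth X p = Some (Plain a) -> available n a ->
      exec n X p.+1 (effect a s) s' -> exec n X p s s'
  | exec_pos p a s s' :
      onth X p = Some (PosTest a) -> available n a ->
      exec n X (if reply a s then p.+1 else p.+2) (effect a s) s' ->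
      exec n X p s s'
  | exec_neg p a s s' :
      onth X p = Some (NegTest a) -> available n a ->
      exec n X (if reply a s then p.+2 else p.+1) (effect a s) s' ->
      exec n X p s s'
  | exec_jump p l s s' :
      onth X p = Some (Jump l) -> 0 < l ->
      exec n X (p + l) s s' -> exec n X p s s'
  | exec_term p s :
      onth X p = Some Term -> exec n X p s s.

Definition init_regs (w : seq bool) : regs :=
  fun f => if f is In i then nth false w i.-1 else false.

Definition computes (X : seq instr) (n : nat) (f : n.-tuple bool -> bool)
    : Prop :=
  forall b : n.-tuple bool,
    exists2 s, exec n X 0 (init_regs b) s & s Out = f b.

Definition P_IS (f : bfamily) : Prop :=
  exists h : {poly nat}, forall n, exists X : seq instr,
    [/\ IS_br X, computes X (fun b : n.-tuple bool => f b)
      & size X <= h.[n]%R].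

(** * P/poly, via polynomial-size Boolean circuits *)

(* A circuit is the list of its gates in topological order: a gate refers to
   earlier ones by their positions, and the last gate is the output.  The
   constant gates only matter when there are no inputs. *)
Inductive gate :=
  | GIn of nat
  | GConst of bool
  | GNot of nat
  | GAnd of nat & nat
  | GOr of nat & nat.

Definition gate_wf (n p : nat) (g : gate) : bool :=
  match g with
  | GIn i => i < n
  | GConst _ => true
  | GNot j => j < p
  | GAnd j k | GOr j k => (j < p) && (k < p)
  end.

Definition circuit := seq gate.

Definition circuit_wf (n : nat) (C : circuit) : Prop :=
  0 < size C /\ forall p g, onth C p = Some g -> gate_wf n p g.

Definition gate_val (w vals : seq bool) (g : gate) : bool :=
  match g with
  | GIn i => nth false w i
  | GConst b => b
  | GNot j => ~~ nth false vals j
  | GAnd j k => nth false vals j && nth false vals k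
  | GOr j k => nth false vals j || nth false vals k
  end.

Definition circuit_vals (C : circuit) (w : seq bool) : seq bool :=
  foldl (fun vals g => rcons vals (gate_val w vals g)) [::] C.

Definition circuit_eval (C : circuit) (w : seq bool) : bool :=
  last false (circuit_vals C w).

(* A language is given by its characteristic function. *)
Definition P_poly (L : seq bool -> bool) : Prop :=
  exists h : {poly nat}, forall n, exists C : circuit,
    [/\ circuit_wf n C,
        forall w : n.-tuple bool, circuit_eval C w = L w
      & size C <= h.[n]%R].

(** * Polynomial-time computability *)

Inductive move := MLeft | MStay | MRight.

(* Deterministic Turing machines with one tape, infinite to the right; the
   tape symbols are the blank [None], the bits and finitely many others. *)
Record tm := Tm {
  tm_state : finType;
  tm_extra : finType;
  tm_start : tm_state;
  tm_halt : pred tm_state;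
  tm_delta : tm_state -> option (bool + tm_extra) ->
             tm_state * option (bool + tm_extra) * move
}.

Definition tm_sym (M : tm) : Type := option (bool + tm_extra M).

Record tm_config (M : tm) := TmConfig {
  cf_state : tm_state M;
  cf_head : nat;
  cf_tape : nat -> tm_sym M
}.

Definition tape_of (M : tm) (w : seq bool) : nat -> tm_sym M :=
  fun p => omap inl (onth w p).

Definition tm_init (M : tm) (w : seq bool) : tm_config M :=
  TmConfig (tm_start M) 0 (tape_of M w).

Definition tm_step (M : tm) (c : tm_config M) : tm_config M :=
  if tm_halt (cf_state c) then c else
  let: (q, a, d) := tm_delta (cf_state c) (cf_tape c (cf_head c)) in
  TmConfig q
    (match d with
     | MLeft => (cf_head c).-1
     | MStay => cf_head c
     | MRight => (cf_head c).+1
     end)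
    (fun p => if p == cf_head c then a else cf_tape c p).

(* The output is the whole content of the tape. *)
Definition tm_outputs (M : tm) (t : nat) (x y : seq bool) : Prop :=
  let c := iter t (@tm_step M) (tm_init M x) in
  tm_halt (cf_state c) /\ forall p, cf_tape c p = tape_of M y p.

Definition poly_time (A B : Type) (encA : A -> seq bool) (encB : B -> seq bool)
    (D : pred A) (f : A -> B) : Prop :=
  exists (M : tm) (h : {poly nat}), forall a, D a ->
    exists2 t, t <= h.[size (encA a)]%R & tm_outputs M t (encA a) (encB (f a)).

(** * Clauses, 3CNF formulas and their encodings *)

(* (j, true) is the literal v_j and (j, false) is ~ v_j, with j >= 1. *)
Definition lit := (nat * bool)%type.

Definition lit_holds (v : nat -> bool) (l : lit) : bool := v l.1 == l.2.

Definition satisfiable (phi : seq (seq lit)) : Prop :=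
  exists v : nat -> bool, all (has (lit_holds v)) phi.

Definition is_3cnf (phi : seq (seq lit)) : bool :=
  all (fun c => (0 < size c <= 3) && all (fun l : lit => 0 < l.1) c) phi.

(* Binary numeral, most significant bit first, no leading zeros. *)
Definition binary (n : nat) : seq bool :=
  rev (mkseq (fun i => odd (n %/ 2 ^ i)) (trunc_log 2 n).+1).

(* Strings over the alphabet {0, 1, comma, semicolon}, two bits per symbol. *)
Definition sym_bit (b : bool) : seq bool := [:: false; b].
Definition sym_comma : seq bool := [:: true; false].
Definition sym_semicolon : seq bool := [:: true; true].

Definition enc_lit (l : lit) : seq bool :=
  flatten [seq sym_bit b | b <- l.2 :: binary l.1] ++ sym_comma.

Definition enc_clause (c : seq lit) : seq bool :=
  flatten [seq enc_lit l | l <- c] ++ sym_semicolon.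

Definition enc_cnf (phi : seq (seq lit)) : seq bool :=
  flatten [seq enc_clause c | c <- phi].

Definition SAT3 : seq bool -> bool := fun w =>
  `[< exists phi, [/\ is_3cnf phi, satisfiable phi & w = enc_cnf phi] >].

(* A set of literals is encoded by listing it in increasing order. *)
Definition lit_le (l m : lit) : bool :=
  (l.1 < m.1) || ((l.1 == m.1) && (l.2 ==> m.2)).

Definition enc_lit_set (L : {fset lit}) : seq bool :=
  enc_clause (sort lit_le (enum_fset L)).

(** * The family 3SATC *)

Definition nd (k : nat) : nat := 'C(2 * k, 1) + 'C(2 * k, 2) + 'C(2 * k, 3).

Lemma nd_ge k : k <= nd k.
Proof. by rewrite /nd bin1 -addnA (leq_trans _ (leq_addr _ _)) // leq_pmull. Qed.

Lemma ex_nd i : exists k, i <= nd k.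
Proof. by exists i; apply: nd_ge. Qed.

Lemma ex_nd_gt n : exists k, n < nd k.+1.
Proof. by exists n; apply: nd_ge. Qed.

Definition clause_set (k : nat) (L : {fset lit}) : Prop :=
  (forall l, l \in L -> 0 < l.1 <= k) /\ 0 < #|` L| <= 3.

(* For i >= 1, the least k with i \in [1, nd k]. *)
Definition level (i : nat) : nat := ex_minn (ex_nd i).

(* The third field says that (alpha_k)^-1 (alpha_(k+1) j) = j. *)
Record is_enumeration (alpha : nat -> nat -> {fset lit}) : Prop := {
  alpha_bij : forall k,
    set_bij [set i | 0 < i <= nd k]%classic [set L | clause_set k L]%classic
      (alpha k);
  alpha_compat : forall k j, 0 < j <= nd k -> alpha k.+1 j = alpha k j;
  alpha_poly_time :
    poly_time binary enc_lit_set (fun i => 0 < i) (fun i => alpha (level i) i)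
}.

(* The k such that nd k <= n < nd k.+1, see [stageP]. *)
Definition stage (n : nat) : nat := ex_minn (ex_nd_gt n).

Lemma stageP n : nd (stage n) <= n < nd (stage n).+1.
Proof.
rewrite /stage; case: ex_minnP => k lt_n min_k; rewrite lt_n andbT.
case: k {lt_n} min_k => [|k] min_k; first by rewrite /nd !bin0n.
by rewrite leqNgt; apply/negP => /min_k; rewrite ltnn.
Qed.

(* The formula selected by the bits b_1, ..., b_(nd k) of w. *)
Definition selected (alpha : nat -> nat -> {fset lit}) (k : nat) (w : seq bool)
    : seq (seq lit) :=
  [seq enum_fset (alpha k i) | i <- iota 1 (nd k) & nth false w i.-1].

Definition SATC3 (alpha : nat -> nat -> {fset lit}) : bfamily := fun w =>
  let k := stage (size w) in
  `[< satisfiable (selected alpha k (take (nd k) w)) >].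

(* Main.v *)
(** Literal occurrences replace variables: over a string of length [m], let
    [x_p] mean that the literal written at position [p] is true.  A 3CNF
    formula is then equisatisfiable with the set of its clauses, read as
    positive clauses in the [x_p], together with the clauses [~ x_p \/ ~ x_q]
    for complementary literals at [p] and [q].  Whether a given clause over the
    [x_p] belongs to this set is decided by a finite automaton or by comparing
    two substrings, hence by a small circuit, and a circuit can follow an
    instruction sequence because jumps only go forward.  Conversely, encodings
    of clause selections are made to have the same length by renaming variable
    [j] to [2j] and replacing the literals of unselected clauses by the positive
    literal [2j+1]; every bit of the encoding then depends on a single input,
    and an instruction sequence evaluates a circuit for 3SAT gate by gate. *)

From HB Require Import structures.
Require Import Defs.
From mathcomp Require Import all_boot all_algebra finmap.
From mathcomp Require Import boolp classical_sets functions.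
From mathcomp Require Import zify.

Set Implicit Arguments.
Unset Strict Implicit.
Unset Printing Implicit Defensive.

Local Open Scope nat_scope.

(** * Polynomially bounded functions *)

(** Only domination is asked, so that costs can be written as plain arithmetic expressions, for
    which [poly_bound] finds a polynomial by closure properties. *)
Definition poly_bounded (g : nat -> nat) : Prop :=
  exists h : {poly nat}, forall n, g n <= h.[n]%R.

Lemma horner_nat_mono (h : {poly nat}) m n : m <= n -> h.[m]%R <= h.[n]%R.
Proof.
move=> le_mn; elim/poly_ind: h => [|p c IH]; first by rewrite !horner0.
by rewrite !hornerMXaddC; apply: leq_add => //; apply: leq_mul.
Qed.

Lemma poly_bounded_le f g :
  (forall n, f n <= g n) -> poly_bounded g -> poly_bounded f.
Proof. by move=> le_fg [h hP]; exists h => n; apply: leq_trans (hP n). Qed.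

Lemma poly_bounded_const c : poly_bounded (fun=> c).
Proof. by exists (c%:P)%R => n; rewrite hornerC. Qed.

Lemma poly_bounded_id : poly_bounded id.
Proof. by exists 'X%R => n; rewrite hornerX. Qed.

Lemma poly_bounded_add f g :
  poly_bounded f -> poly_bounded g -> poly_bounded (fun n => f n + g n).
Proof.
by move=> [p pP] [q qP]; exists (p + q)%R => n; rewrite hornerD leq_add.
Qed.

Lemma poly_bounded_mul f g :
  poly_bounded f -> poly_bounded g -> poly_bounded (fun n => f n * g n).
Proof.
by move=> [p pP] [q qP]; exists (p * q)%R => n; rewrite hornerM leq_mul.
Qed.

Lemma poly_bounded_horner (h : {poly nat}) f :
  poly_bounded f -> poly_bounded (fun n => h.[f n]%R).
Proof.
by move=> [p pP]; exists (h \Po p)%R => n; rewrite horner_comp horner_nat_mono.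
Qed.

Lemma poly_boundedS f : poly_bounded f -> poly_bounded (fun n => (f n).+1).
Proof.
move=> fP; apply: (@poly_bounded_le _ (fun n => f n + 1)) => [n|].
  by rewrite addn1.
exact: poly_bounded_add (poly_bounded_const _).
Qed.

Ltac poly_bound := repeat first
  [ exact: poly_bounded_const | exact: poly_bounded_id
  | apply: poly_bounded_horner | apply: poly_boundedS
  | apply: poly_bounded_add | apply: poly_bounded_mul ].

(** * Functions derivable by extending a circuit *)

Section Derivable.

Variable n : nat.

Implicit Types (C D : circuit) (f g h : seq bool -> bool).
Implicit Types (S T : (seq bool -> bool) -> Prop).

Definition wf_gates C := forall p (u : gate), onth C p = Some u -> gate_wf n p u.

Definition computed C f :=
  exists2 i, i < size C &
    forall w, size w = n -> nth false (circuit_vals C w) i = f w.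

(* Sharing is what separates circuits from formulas: the functions in [S] are
   available for free, as values of gates already present. *)
Record derivable S c f : Prop := Derivable {
  derivableP : forall C, wf_gates C -> (forall g, S g -> computed C g) ->
    exists D, [/\ wf_gates (C ++ D), size D <= c & computed (C ++ D) f]
}.

Lemma circuit_vals_rcons C (g : gate) w :
  circuit_vals (rcons C g) w =
  rcons (circuit_vals C w) (gate_val w (circuit_vals C w) g).
Proof. by rewrite /circuit_vals -cats1 foldl_cat. Qed.

Lemma size_circuit_vals C w : size (circuit_vals C w) = size C.
Proof.
by elim/last_ind: C => // C g IH; rewrite circuit_vals_rcons !size_rcons IH.
Qed.

Lemma nth_circuit_vals_cat C D w i : i < size C ->
  nth false (circuit_vals (C ++ D) w) i = nth false (circuit_vals C w) i.
Proof.
move=> ltiC; elim/last_ind: D => [|D g IH]; first by rewrite cats0.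
rewrite -rcons_cat circuit_vals_rcons nth_rcons size_circuit_vals size_cat.
by rewrite ltn_addr // IH.
Qed.

Lemma computed_cat C D f : computed C f -> computed (C ++ D) f.
Proof.
case=> i ltiC iP; exists i; first by rewrite size_cat ltn_addr.
by move=> w /iP <-; apply: nth_circuit_vals_cat.
Qed.

Lemma wf_gates_rcons C (g : gate) :
  wf_gates C -> gate_wf n (size C) g -> wf_gates (rcons C g).
Proof.
move=> wfC wfg p g'; rewrite -cats1 onth_cat; case: ltnP => [_|leCp]; first exact: wfC.
move/onth1P => [/eqP eq0 <-].
by suff -> : p = size C by []; apply/eqP; rewrite eqn_leq leCp andbT -subn_eq0.
Qed.

Lemma wf_gates_prefix C (g : gate) : wf_gates (rcons C g) ->
  wf_gates C /\ gate_wf n (size C) g.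
Proof.
move=> wfC; split=> [p g' Cp|]; last first.
  by apply: wfC; rewrite -cats1 onth_cat ltnn subnn.
apply: wfC; rewrite -cats1 onth_cat; case: ltnP => //.
by rewrite -onthNE Cp.
Qed.

Lemma computed_rcons C (g : gate) f :
    (forall w, size w = n -> gate_val w (circuit_vals C w) g = f w) ->
  computed (rcons C g) f.
Proof.
move=> gP; exists (size C) => [|w szw]; first by rewrite size_rcons.
by rewrite circuit_vals_rcons nth_rcons size_circuit_vals ltnn eqxx gP.
Qed.

Lemma derivable_weaken S T c d f :
  (forall g, S g -> T g) -> c <= d -> derivable S c f -> derivable T d f.
Proof.
move=> sub lecd Sf; split=> C wfC TC.
have [|D [wfD leD CDf]] := derivableP Sf wfC; first by move=> g /sub /TC.
by exists D; split=> //; apply: leq_trans lecd.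
Qed.

Lemma derivable_le S c d f : c <= d -> derivable S c f -> derivable S d f.
Proof. exact: derivable_weaken. Qed.

Lemma derivable_ext S c f g : (forall w, size w = n -> f w = g w) ->
  derivable S c f -> derivable S c g.
Proof.
move=> eqfg Sf; split=> C wfC SC; have [D [wfD leD [i lti iP]]] := derivableP Sf wfC SC.
by exists D; split=> //; exists i => // w szw; rewrite -eqfg // iP.
Qed.

Lemma derivable_hyp S f : S f -> derivable S 0 f.
Proof. by move=> Sf; split=> C wfC SC; exists [::]; rewrite cats0; split=> //;
  apply: SC. Qed.

Lemma derivable_gate0 S (g : gate) f :
    (forall p, gate_wf n p g) ->
    (forall w vals, size w = n -> gate_val w vals g = f w) ->
  derivable S 1 f.
Proof.
move=> wfg gP; split=> C wfC SC; exists [:: g]; rewrite cats1; split=> //.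
  exact: wf_gates_rcons.
by apply: computed_rcons => w; apply: gP.
Qed.

Lemma derivable_const S b : derivable S 1 (fun=> b).
Proof. exact: (@derivable_gate0 _ (GConst b)). Qed.

Lemma derivable_nth S i : derivable S 1 (fun w => nth false w i).
Proof.
have [ltin|lein] := ltnP i n; first exact: (@derivable_gate0 _ (GIn i)).
apply: derivable_ext _ (derivable_const S false) => w szw.
by rewrite nth_default // szw.
Qed.

Lemma derivable_not S c f : derivable S c f ->
  derivable S c.+1 (fun w => ~~ f w).
Proof.
move=> Sf; split=> C wfC SC; have [D [wfD leD [i lti iP]]] := derivableP Sf wfC SC.
exists (rcons D (GNot i)); rewrite -rcons_cat size_rcons; split=> //.
  exact: wf_gates_rcons.
by apply: computed_rcons => w szw /=; rewrite iP.
Qed.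

Lemma derivable_gate2 S c d f g h G :
    (forall p j k, gate_wf n p (G j k) = (j < p) && (k < p)) ->
    (forall w vals j k, nth false vals j = f w -> nth false vals k = g w ->
      gate_val w vals (G j k) = h w) ->
  derivable S c f -> derivable S d g -> derivable S (c + d).+1 h.
Proof.
move=> wfG GP Sf Sg; split=> C wfC SC; have [D [wfD leD CDf]] := derivableP Sf wfC SC.
have [|D' [wfD' leD' [j ltj jP]]] := derivableP Sg wfD.
  by move=> g' /SC; apply: computed_cat.
have [i lti iP] := computed_cat D' CDf.
exists (rcons (D ++ D') (G i j)); rewrite -rcons_cat catA; split.
- by apply: wf_gates_rcons => //; rewrite wfG lti.
- by rewrite size_rcons ltnS size_cat leq_add.
- by apply: computed_rcons => w szw; apply: GP; rewrite ?iP ?jP.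
Qed.

Lemma derivable_and S c d f g : derivable S c f -> derivable S d g ->
  derivable S (c + d).+1 (fun w => f w && g w).
Proof. by apply: (@derivable_gate2 _ _ _ _ _ _ GAnd) => //= w vals j k -> ->. Qed.

Lemma derivable_or S c d f g : derivable S c f -> derivable S d g ->
  derivable S (c + d).+1 (fun w => f w || g w).
Proof. by apply: (@derivable_gate2 _ _ _ _ _ _ GOr) => //= w vals j k -> ->. Qed.

Lemma derivable_if S c d e f g h :
  derivable S c f -> derivable S d g -> derivable S e h ->
  derivable S (2 * c + d + e + 4) (fun w => if f w then g w else h w).
Proof.
move=> Sf Sg Sh.
apply: derivable_le (derivable_ext _
  (derivable_or (derivable_and Sf Sg) (derivable_and (derivable_not Sf) Sh))).
  by lia.
by move=> w _; case: (f w); rewrite ?orbF.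
Qed.

Lemma derivable_eq S c d f g : derivable S c f -> derivable S d g ->
  derivable S (2 * c + 2 * d + 5) (fun w => f w == g w).
Proof.
move=> Sf Sg; apply: derivable_le (derivable_ext _
  (derivable_or (derivable_and Sf Sg)
     (derivable_and (derivable_not Sf) (derivable_not Sg)))).
  by lia.
by move=> w _; case: (f w); case: (g w).
Qed.

Section Families.

Context {J : eqType}.
Implicit Types (I : seq J) (F : J -> seq bool -> bool).

Lemma derivable_has S c I F : (forall i, i \in I -> derivable S c (F i)) ->
  derivable S (size I * c.+1).+1 (fun w => has (F^~ w) I).
Proof.
elim: I => [_|i I IH SF]; first exact: derivable_const.
apply: derivable_le (derivable_or (SF i (mem_head i I)) (IH _));
  first by rewrite /=; lia.
by move=> j jI; apply: SF; rewrite inE jI orbT.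
Qed.

Lemma derivable_all S c I F : (forall i, i \in I -> derivable S c (F i)) ->
  derivable S (size I * c.+1).+1 (fun w => all (F^~ w) I).
Proof.
elim: I => [_|i I IH SF]; first exact: derivable_const.
apply: derivable_le (derivable_and (SF i (mem_head i I)) (IH _));
  first by rewrite /=; lia.
by move=> j jI; apply: SF; rewrite inE jI orbT.
Qed.

Definition extended S I F g := S g \/ exists2 i, i \in I & g = F i.

(** The gates for the [F i] are laid down once and then shared, so costs add up instead of
    multiplying. The induction on [I] moves one [F i] at a time into the set of available
    functions. *)
Lemma derivable_cut S c d I F g : (forall i, i \in I -> derivable S c (F i)) ->
  derivable (extended S I F) d g -> derivable S (size I * c + d) g.
Proof.
elim: I S => [|i I IH] S SF Fg.
  by apply: derivable_weaken Fg => [f []// []|]//=.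
split=> C wfC SC; have [D [wfD leD CDi]] := derivableP (SF i (mem_head i I)) wfC SC.
have /IH Ig : derivable (extended (extended S [:: i] F) I F) d g.
  apply: derivable_weaken Fg => // f [Sf|[j]]; first by left; left.
  rewrite inE => /orP[/eqP -> -> | jI ->]; last by right; exists j.
  by left; right; exists i; rewrite ?inE.
have Igd : derivable (extended S [:: i] F) (size I * c + d) g.
  apply: Ig => j jI; apply: (@derivable_weaken S _ c) => //; first by left.
  by apply: SF; rewrite inE jI orbT.
have [|D' [wfD' leD' CDg]] := derivableP Igd wfD.
  move=> f [/SC|[j]]; first exact: computed_cat.
  by rewrite inE => /eqP -> ->.
exists (D ++ D'); rewrite catA size_cat; split=> //=.
by rewrite mulSn -addnA leq_add.
Qed.

(** Each layer reads only [S] and the layer before it. Cutting the layers away from the last one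
    downwards keeps the cost linear in their number. *)
Lemma derivable_layers S c d I (F : nat -> J -> seq bool -> bool) N g :
    (forall i, i \in I -> derivable S c (F 0 i)) ->
    (forall t i, t < N -> i \in I ->
      derivable (extended S I (F t)) c (F t.+1 i)) ->
  derivable (extended S I (F N)) d g ->
  derivable S (N.+1 * (size I * c) + d) g.
Proof.
move=> S0; elim: N d g => [|N IH] d g Ssucc Sg.
  by rewrite mul1n; apply: derivable_cut Sg.
rewrite mulSn -addnA addnCA; apply: IH => [t i ltN|].
  exact/Ssucc/ltnW.
apply: (@derivable_cut _ _ _ I (F N.+1)).
  by move=> i iI; apply: Ssucc.
by apply: derivable_weaken Sg => // f [Sf|[j jI ->]]; [left; left | right; exists j].
Qed.

End Families.

(** A finite automaton is unrolled in time, with one Boolean per time and state; for fixed [Q], [T]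
    and [c] the cost is linear in [N]. *)
Lemma derivable_scan S c (Q T : finType) (x : nat -> seq bool -> T)
    (delta : nat -> Q -> T -> Q) (state : nat -> seq bool -> Q) N (P : pred Q) q0 :
    (forall t a, t < N -> derivable S c (fun w => x t w == a)) ->
    (forall w, size w = n -> state 0 w = q0) ->
    (forall t w, t < N -> size w = n ->
      state t.+1 w = delta t (state t w) (x t w)) ->
  derivable S (N.+1 * (#|Q| * (#|{: Q * T}| * c.+4).+1) + (#|Q| * 3).+1)
    (fun w => P (state N w)).
Proof.
move=> Sx st0 stS; pose F t q w := state t w == q.
have cardE (X : finType) : size (enum X) = #|X| by rewrite cardE.
rewrite -{1}[#|Q|]cardE; apply: (@derivable_layers _ S _ _ (enum Q) F).
- move=> q _; apply: (@derivable_le _ 1) => //.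
  by apply: derivable_ext _ (derivable_const _ (q0 == q)) => w /st0; rewrite /F => ->.
- move=> t q ltN _; rewrite -(cardE {: Q * T}).
  (* The next state is [q] iff some pair of current state and symbol leads to [q]. *)
  pose G (ua : Q * T) w := [&& delta t ua.1 ua.2 == q, F t ua.1 w & x t w == ua.2].
  apply: (@derivable_ext _ _ (fun w => has (G^~ w) (enum {: Q * T}))).
    move=> w szw; rewrite /F stS //; apply/hasP/eqP.
      by case=> -[u a] _ /and3P[/eqP <- /= /eqP -> /eqP ->].
    by move=> eq_q; exists (state t w, x t w); rewrite ?mem_enum // /G /F /= eq_q !eqxx.
  apply: derivable_has => -[u a] _; rewrite /G /=.
  apply: derivable_le (derivable_and (derivable_const _ _)
    (derivable_and (derivable_hyp _) (derivable_weaken _ (leqnn c) (Sx t a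
      ltN)))) => //.
  + by right; exists u; rewrite ?mem_enum.
  + by left.
- rewrite -[#|Q|]cardE.
  apply: (@derivable_ext _ _ (fun w => has (fun q => P q && F N q w) (enum Q))).
    move=> w _; apply/hasP/idP; first by case=> q _ /andP[Pq /eqP ->].
    by move=> PN; exists (state N w); rewrite ?mem_enum // PN /F eqxx.
  apply: derivable_has => q _.
  by apply: derivable_le (derivable_and (derivable_const _ _) (derivable_hyp _));
    last by right; exists q; rewrite ?mem_enum.
Qed.

Lemma circuit_of_derivable c f : derivable (fun=> False) c f ->
  exists C, [/\ circuit_wf n C, forall w : n.-tuple bool, circuit_eval C w = f w
    & size C <= c.+1].
Proof.
have wf0 : wf_gates [::] by move=> p g; rewrite onth0n.
move=> /derivableP /(_ _ wf0) [//|D /= [wfD leD [i lti iP]]].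
(* The output of a circuit is its last gate, so [GOr i i] copies gate [i] to the end. *)
exists (rcons D (GOr i i)); split.
- split; first by rewrite size_rcons.
  by apply: wf_gates_rcons; rewrite //= lti.
- move=> w; rewrite /circuit_eval circuit_vals_rcons last_rcons /= orbb iP //.
  by rewrite size_tuple.
- by rewrite size_rcons.
Qed.

End Derivable.

(** * Circuits simulating instruction sequences *)

Lemma focus_eqP : Equality.axiom focus_eqb.
Proof.
case=> [i|i|] [j|j|] /=; try by constructor.
- by apply: (iffP eqP) => [->|[]].
- by apply: (iffP eqP) => [->|[]].
Qed.

HB.instance Definition _ := hasDecEq.Build focus focus_eqP.

Lemma effectE f m s g :
  effect (Basic f m) s g = if g == f then new_content m (s f) else s g.
Proof. by []. Qed.

(* Jumps only go forward, so visiting each position once, in increasing order,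
   and executing the instruction there when the program counter points to it
   performs the whole execution. *)
Definition sweep_step (X : seq instr) (cfg : nat * regs) (p : nat) :
    nat * regs :=
  let: (pc, s) := cfg in
  if pc == p then
    match onth X p with
    | Some (Plain a) => (p.+1, effect a s)
    | Some (PosTest a) => (if reply a s then p.+1 else p.+2, effect a s)
    | Some (NegTest a) => (if reply a s then p.+2 else p.+1, effect a s)
    | Some (Jump l) => (p + l, s)
    | _ => cfg
    end
  else cfg.

Definition sweep X cfg p k := foldl (sweep_step X) cfg (iota p k).

Lemma sweep_past X pc s p k : pc < p -> sweep X (pc, s) p k = (pc, s).
Proof.
rewrite /sweep; elim: k p => //= k IH p ltp.
by rewrite ltn_eqF // IH // ltnS ltnW.
Qed.

(** This absorbs forward moves: the positions passed over by a skip or a jump are visited without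
    effect. *)
Lemma sweep_skip X pc s p : p <= pc ->
  sweep X (pc, s) p (size X - p) = sweep X (pc, s) pc (size X - pc).
Proof.
move/subnKC <-; move: (pc - p) => d; elim: d p => [|d IH] p.
  by rewrite addn0.
have [ltp|leXp] := ltnP p (size X); last first.
  have /eqP -> : size X - p == 0 by rewrite subn_eq0.
  have /eqP -> // : size X - (p + d.+1) == 0.
  by rewrite subn_eq0 (leq_trans leXp) ?leq_addr.
rewrite -addSnnS -IH -(subnSK ltp) /sweep /=.
by rewrite gtn_eqF // addSn ltnS leq_addr.
Qed.

Lemma exec_sweep n X p s s' : exec n X p s s' ->
  (sweep X (p, s) p (size X - p)).2 = s'.
Proof.
have step q t u : onth X q = Some u ->
    sweep X (q, t) q (size X - q) =
    sweep X (sweep_step X (q, t) q) q.+1 (size X - q.+1).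
  move=> Xq; have ltq : q < size X by rewrite -onthTE Xq.
  by rewrite -(subnSK ltq).
elim=> {p s s'} [p a s s' Xp _ _|p a s s' Xp _ _|p a s s' Xp _ _|p l s s' Xp l0
  _|p s Xp];
  rewrite (step _ _ _ Xp) /= eqxx Xp.
- by [].
- by move=> <-; rewrite (@sweep_skip _ _ _ p.+1) //; case: ifP.
- by move=> <-; rewrite (@sweep_skip _ _ _ p.+1) //; case: ifP.
- by move=> <-; rewrite (@sweep_skip _ _ _ p.+1) // -addn1 leq_add2l.
(* Termination leaves the program counter at [p], which no later position matches. *)
- by rewrite sweep_past.
Qed.

Definition instr_focus (u : instr) : focus :=
  if u is (Plain (Basic f _) | PosTest (Basic f _) | NegTest (Basic f _))
  then f else Out.

(** Layer [t] records, just before position [t] is visited, where the program counter stands and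
    what [out] and the registers occurring in [X] contain. Each bit of the next layer depends on at
    most three bits of this one. The functions of cost [c] enter in layer 0 only. *)
Lemma derivable_sweep n S c (X : seq instr) (bv : seq bool -> seq bool) :
    (forall i, derivable n S c (fun w => nth false (bv w) i)) ->
  derivable n S ((size X).+1 * ((size X + (size X).+1) * (c + 10)))
    (fun w => (sweep X (0, init_regs (bv w)) 0 (size X)).2 Out).
Proof.
move=> Sbv; pose conf t w := sweep X (0, init_regs (bv w)) 0 t.
have confS t w : conf t.+1 w = sweep_step X (conf t w) t.
  by rewrite /conf /sweep -(addn1 t) iotaD foldl_cat.
pose F t (i : nat + focus) w :=
  match i with inl q => (conf t w).1 == q | inr f => (conf t w).2 f end.
pose foci := Out :: map instr_focus X.
pose I : seq (nat + focus) := map inl (iota 0 (size X)) ++ map inr foci.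
have szI : size I = size X + (size X).+1.
  by rewrite size_cat !size_map size_iota /= size_map.
have IpcP t : t < size X -> inl t \in I.
  by move=> ltt; rewrite mem_cat map_f // mem_iota.
have IregP f : f \in foci -> inr f \in I.
  by move=> ff; rewrite mem_cat orbC map_f.
rewrite -szI -[_ * _]addn0; apply: (@derivable_layers _ _ _ _ _ _ F).
- have S1 b : derivable n S (c + 10) (fun=> b).
    by apply: derivable_le (derivable_const n S b); rewrite addn_gt0 orbT.
  case=> [q|[i|i|]] _ /=; try exact: S1.
  by apply: derivable_le (Sbv i.-1); rewrite leq_addr.
- move=> t i ltt iI; set S' := extended _ _ _.
  have [u Xt] : exists u, onth X t = Some u.
    by case: (onth X t) (onthTE X t) => [u _|]; [exists u | rewrite ltt].
  have pcP : derivable n S' 0 (F t (inl t)).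
    by apply: derivable_hyp; right; exists (inl t); rewrite ?IpcP.
  have iP : derivable n S' 0 (F t i).
    by apply: derivable_hyp; right; exists i.
  have uP : derivable n S' 0 (F t (inr (instr_focus u))).
    apply: derivable_hyp; right; exists (inr (instr_focus u)) => //.
    apply: IregP; rewrite inE; apply/orP; right.
    by apply/onthP; exists t; rewrite onth_map Xt.
  (* Where control goes from position [t] depends on the content of at most one register, that of
     [u]. Two nested conditionals of constant size cost 10. *)
  have pc_next q (b1 b2 : bool) :
      (forall w, (conf t w).1 = t ->
        (F t.+1 (inl q) w = if F t (inr (instr_focus u)) w then b1 else b2)) ->
      i = inl q -> derivable n S' (c + 10) (F t.+1 i).
    move=> nextP ei; apply: derivable_le (derivable_ext _ (derivable_if pcP
      (derivable_if uP (derivable_const n S' b1) (derivable_const n S' b2)) iP)).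
      by lia.
    move=> w _; rewrite ei; case: ifP => [/eqP /nextP -> //|].
    by rewrite /F confS; case: (conf t w) => pc s /= ->.
  have reg_next f :
      (forall w, (conf t w).1 = t -> F t.+1 (inr f) w =
        if u is (Plain a | PosTest a | NegTest a) then effect a (conf t w).2 f
        else (conf t w).2 f) ->
      i = inr f -> derivable n S' (c + 10) (F t.+1 i).
    move=> nextP ei.
    (* Here [b] is [Some] of the new content if the instruction sets [f], and [None] if it leaves
       [f] unchanged. *)
    have [b bP] : exists b, forall w, (conf t w).1 = t ->
         F t.+1 i w = if b is Some b' then b' else F t i w.
      rewrite ei; case: u {uP Xt pc_next} nextP => [[g m]|[g m]|[g m]|l|] nextP;
        try (by exists None => w /nextP ->);
        by exists (if (f == g) then if m is Set_ b then Some b else None else None)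
          => w /nextP ->; rewrite effectE; case: eqP => [->|//]; case: m {nextP}.
    have bP' : derivable n S' 1 (fun w => if b is Some b' then b' else F t i w).
      case: b {bP} => [b|]; first exact: derivable_const.
      exact: derivable_le iP.
    apply: derivable_le (derivable_ext _ (derivable_if pcP bP' iP)); first by lia.
    move=> w _; case: ifP => [/eqP /bP -> //|].
    by rewrite ei /F confS; case: (conf t w) => pc s /= ->.
  have stepE w : (conf t w).1 = t -> conf t.+1 w =
     match u with
     | Plain a => (t.+1, effect a (conf t w).2)
     | PosTest a => (if reply a (conf t w).2 then t.+1 else t.+2,
                     effect a (conf t w).2)
     | NegTest a => (if reply a (conf t w).2 then t.+2 else t.+1,
                     effect a (conf t w).2)
     | Jump l => (t + l, (conf t w).2)
     | Term => conf t w
     end.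
    by rewrite confS; case: (conf t w) => pc s /= ->; rewrite eqxx Xt; case: (u).
  case ei: i => [q|f]; rewrite -ei; last first.
    apply: reg_next ei => w /stepE; rewrite /F => ->.
    by case: (u) => [a|a|a|l|].
  case: (u) stepE pc_next => [[g m]|[g m]|[g m]|l|] stepE pc_next.
  + by apply: (pc_next q (t.+1 == q) (t.+1 == q)) => // w /stepE;
      rewrite /F => -> /=; case: ifP.
  + case: m stepE pc_next => [b|] stepE pc_next.
      apply: (pc_next q ((if b then t.+1 else t.+2) == q) ((if b then t.+1 else
        t.+2) == q)) => //.
      by move=> w /stepE; rewrite /F => -> /=; rewrite if_same.
    apply: (pc_next q (t.+1 == q) (t.+2 == q)) => //.
    by move=> w /stepE; rewrite /F => -> /=; case: ifP.
  + case: m stepE pc_next => [b|] stepE pc_next.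
      apply: (pc_next q ((if b then t.+2 else t.+1) == q) ((if b then t.+2 else
        t.+1) == q)) => //.
      by move=> w /stepE; rewrite /F => -> /=; rewrite if_same.
    apply: (pc_next q (t.+2 == q) (t.+1 == q)) => //.
    by move=> w /stepE; rewrite /F => -> /=; case: ifP.
  + by apply: (pc_next q (t + l == q) (t + l == q)) => // w /stepE;
      rewrite /F => -> /=; rewrite if_same.
  + by apply: (pc_next q (t == q) (t == q)) => // w pct;
      rewrite if_same /F (stepE _ pct) pct.
- by apply: derivable_hyp; right; exists (inr Out) => //; apply: IregP;
    rewrite mem_head.
Qed.

(** * Instruction sequences evaluating circuits *)

Lemma effect_get f s : effect (Basic f Get) s = s.
Proof.
by apply: funext => g; rewrite effectE; case: eqP => [->|].
Qed.

Definition embeds (X : seq instr) p (code : seq instr) :=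
  forall i, i < size code -> onth X (p + i) = onth code i.

(** Since [exec] always runs up to [Term], a fragment is described by how it prolongs an execution
    of what follows it. Quantifying over [X] and [p] makes it relocatable. *)
Definition carries n (code : seq instr) (s s' : regs) :=
  forall X p t, embeds X p code -> exec n X (p + size code) s' t ->
    exec n X p s t.

Lemma carries_nil n s : carries n [::] s s.
Proof. by move=> X p t _; rewrite addn0. Qed.

Lemma carries_cat n code1 code2 s1 s2 s3 :
  carries n code1 s1 s2 -> carries n code2 s2 s3 ->
  carries n (code1 ++ code2) s1 s3.
Proof.
move=> c12 c23 X p t eX; rewrite size_cat addnA => ex3.
apply: c12 => [i lti|]; first by rewrite eX ?size_cat ?ltn_addr // onth_cat lti.
apply: c23 ex3 => i lti; rewrite -addnA eX ?size_cat ?ltn_add2l //.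
by rewrite onth_cat ltnNge leq_addr addKn.
Qed.

Notation get f := (Basic f Get).

Section Branches.

Variables (n : nat) (a : basic).
Hypothesis an : available n a.

Lemma carries_plain s : carries n [:: Plain a] s (effect a s).
Proof.
move=> X p t eX; rewrite addn1; apply: exec_plain an.
by have /= := eX 0 isT; rewrite addn0.
Qed.

Lemma carries_if_get f s : available n (get f) ->
  carries n [:: PosTest (get f); Plain a] s (if s f then effect a s else s).
Proof.
move=> fn X p t eX; rewrite addn2 => ex.
have X0 := eX 0 isT; have X1 := eX 1 isT; rewrite addn0 addn1 in X0 X1.
apply: (exec_pos X0 fn); rewrite effect_get /=.
by case: (s f) ex => // ex; apply: exec_plain X1 an _.
Qed.

Lemma carries_ifn_get f s : available n (get f) ->
  carries n [:: NegTest (get f); Plain a] s (if ~~ s f then effect a s else s).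
Proof.
move=> fn X p t eX; rewrite addn2 => ex.
have X0 := eX 0 isT; have X1 := eX 1 isT; rewrite addn0 addn1 in X0 X1.
apply: (exec_neg X0 fn); rewrite effect_get /=.
by case: (s f) ex => // ex; apply: exec_plain X1 an _.
Qed.

(** If [f] holds, the negative test skips the jump; otherwise the jump, being the second
    instruction, leads just behind the fragment. *)
Lemma carries_if_and f g s : available n (get f) -> available n (get g) ->
  carries n [:: NegTest (get f); Jump 3; PosTest (get g); Plain a] s
    (if s f && s g then effect a s else s).
Proof.
move=> fn gn X p t eX; rewrite addn4 => ex.
have X0 := eX 0 isT; have X1 := eX 1 isT.
have X2 := eX 2 isT; have X3 := eX 3 isT.
rewrite addn0 addn1 addn2 addn3 in X0 X1 X2 X3.
apply: (exec_neg X0 fn); rewrite effect_get /=.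
case: (s f) ex => /= ex; last by apply: exec_jump X1 _ _; rewrite ?addn3.
apply: (exec_pos X2 gn); rewrite effect_get /=.
by case: (s g) ex => // ex; apply: exec_plain X3 an _.
Qed.

Lemma carries_if_or f g s : available n (get f) -> available n (get g) ->
  carries n [:: NegTest (get f); PosTest (get g); Plain a] s
    (if s f || s g then effect a s else s).
Proof.
move=> fn gn X p t eX; rewrite addn3 => ex.
have X0 := eX 0 isT; have X1 := eX 1 isT; have X2 := eX 2 isT.
rewrite addn0 addn1 addn2 in X0 X1 X2.
apply: (exec_neg X0 fn); rewrite effect_get /=.
case: (s f) ex => /= ex; first exact: exec_plain X2 an _.
apply: (exec_pos X1 gn); rewrite effect_get /=.
by case: (s g) ex => // ex; apply: exec_plain X2 an _.
Qed.

End Branches.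

(* Gate [j] is kept in [aux:(j+1)]; registers of gates still to come contain
   [false], which is also the default value of [nth]. *)
Definition holds (w vals : seq bool) (s : regs) :=
  [/\ forall i, s (In i.+1) = nth false w i, s Out = false
    & forall j, s (Aux j.+1) = nth false vals j].

Lemma holds_init w : holds w [::] (init_regs w).
Proof. by split=> // j; rewrite nth_nil. Qed.

Lemma holds_rcons w vals s v : holds w vals s ->
  holds w (rcons vals v)
    (if v then effect (Basic (Aux (size vals).+1) (Set_ true)) s else s).
Proof.
case=> sIn sOut sAux; case: v; split=> // j; rewrite ?effectE //.
  rewrite nth_rcons; case: eqP => [[->]|ne]; first by rewrite ltnn eqxx.
  case: ltngtP => [|gtj|ej] //; last by case: ne; rewrite ej.
  by rewrite sAux nth_default // ltnW.
rewrite nth_rcons sAux; case: ltnP => // lej.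
by rewrite nth_default // if_same.
Qed.

(** A circuit input fed with such a bit costs at most one test of an input register. Constant bits
    are exempt from [j < n], as no register is read for them. *)
Definition bitwise n (E : seq bool -> seq bool) :=
  forall p, exists j c1 c0, (j < n \/ c1 = c0) /\
    forall w, nth false (E w) p = if nth false w j then c1 else c0.

Lemma gate_code n m E q g : bitwise n E -> gate_wf m q g ->
  exists code, [/\ all instr_br code, size code <= 4
    & forall w vals s, size vals = q -> holds w vals s ->
      let v := gate_val (E w) vals g in
      carries n code s
        (if v then effect (Basic (Aux (size vals).+1) (Set_ true)) s else s)].
Proof.
move=> EP; pose a := Basic (Aux q.+1) (Set_ true).
have constP b : exists code, [/\ all instr_br code, size code <= 4
    & forall s, carries n code s (if b then effect a s else s)].
  case: b; last by exists [::]; split=> // s; apply: carries_nil.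
  by exists [:: Plain a]; split=> // s; apply: carries_plain.
case: g => [p|b|j|j k|j k] _.
- have [j [c1 [c0 [ltj jP]]]] := EP p.
  have [eqc|nec] := eqVneq c1 c0.
    have [code [br sz codeP]] := constP c0; exists code; split=> //= w vals s szv _.
    by rewrite jP eqc if_same szv.
  have {}ltj : j < n by case: ltj => // eqc; rewrite eqc eqxx in nec.
  (* As [c1] and [c0] differ, the bit is input [j] or its negation, which the polarity of the test
     reflects. *)
  exists [:: if c1 then PosTest (get (In j.+1)) else NegTest (get (In j.+1)); Plain a].
  split=> //; first by case: (c1).
  move=> w vals s szv [sIn _ _] /=; rewrite jP -sIn szv.
  case: c1 c0 nec {jP} => -[] // _.
    have := @carries_if_get n a isT (In j.+1) s ltj.
    by case: (s (In j.+1)).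
  have := @carries_ifn_get n a isT (In j.+1) s ltj.
  by case: (s (In j.+1)).
- have [code [br sz codeP]] := constP b; exists code; split=> //= w vals s szv _.
  by rewrite szv.
- exists [:: NegTest (get (Aux j.+1)); Plain a]; split=> // w vals s szv [_ _ sA] /=.
  by rewrite -sA szv; apply: carries_ifn_get.
- exists [:: NegTest (get (Aux j.+1)); Jump 3; PosTest (get (Aux k.+1)); Plain a].
  by split=> // w vals s szv [_ _ sA] /=; rewrite -!sA szv; apply: carries_if_and.
- exists [:: NegTest (get (Aux j.+1)); PosTest (get (Aux k.+1)); Plain a].
  by split=> // w vals s szv [_ _ sA] /=; rewrite -!sA szv; apply: carries_if_or.
Qed.

Lemma circuit_code n m E C : bitwise n E -> wf_gates m C ->
  exists code, [/\ all instr_br code, size code <= 4 * size C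
    & forall w, exists2 s, holds w (circuit_vals C (E w)) s
        & carries n code (init_regs w) s].
Proof.
move=> EP; elim/last_ind: C => [_|C g IH /wf_gates_prefix[/IH [code [br sz codeP]]]].
  exists [::]; split=> // w; exists (init_regs w); last exact: carries_nil.
  exact: holds_init.
move=> /(gate_code EP) [code' [br' sz' code'P]].
exists (code ++ code'); split.
- by rewrite all_cat br.
- by rewrite size_cat size_rcons mulnS addnC leq_add.
- move=> w; have [s sP ex] := codeP w.
  rewrite circuit_vals_rcons; eexists; first exact: holds_rcons sP.
  by apply: carries_cat ex _; apply: code'P; rewrite ?size_circuit_vals.
Qed.

Lemma computes_circuit n m E C : bitwise n E -> circuit_wf m C ->
  exists X, [/\ IS_br X,
    computes X (fun b : n.-tuple bool => circuit_eval C (E b))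
    & size X <= 4 * size C + 3].
Proof.
move=> EP [C0 wfC]; have [code [br sz codeP]] := circuit_code EP wfC.
(* The last gate has index [(size C).-1] and hence lives in register [Aux (size C)]. *)
pose out := [:: PosTest (get (Aux (size C))); Plain (Basic Out (Set_ true))].
exists ((code ++ out) ++ [:: Term]); split.
- by rewrite /IS_br !all_cat br /= C0 !size_cat !addnS.
- move=> b; have [s [_ sO sA] ex] := codeP b.
  have e : circuit_eval C (E b) = s (Aux (size C)).
    by rewrite -(prednK C0) sA /circuit_eval -nth_last size_circuit_vals.
  rewrite e.
  exists (if s (Aux (size C)) then effect (Basic Out (Set_ true)) s else s); last first.
    by case: ifP.
  have outP := @carries_if_get n (Basic Out (Set_ true)) isT (Aux (size C)) s isT.
  apply: (carries_cat ex outP (p := 0)).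
    by move=> i lti; rewrite onth_cat lti.
  by apply: exec_term; rewrite onth_cat ltnn subnn.
- by rewrite !size_cat /= -addnA leq_add2r.
Qed.

(** * Parsing encoded formulas *)

(** The pair [(false, b)] is the digit [b], [(true, false)] the comma and [(true, true)] the
    semicolon. *)
Notation symbol := (bool * bool)%type.

Definition bits_of (ss : seq symbol) : seq bool :=
  flatten [seq [:: x.1; x.2] | x <- ss].

Definition symbols_lit (l : lit) : seq symbol :=
  (false, l.2) :: rcons [seq (false, b) | b <- binary l.1] (true, false).

Definition symbols_clause (c : seq lit) : seq symbol :=
  rcons (flatten (map symbols_lit c)) (true, true).

Definition symbols_cnf (phi : seq (seq lit)) : seq symbol :=
  flatten (map symbols_clause phi).

Lemma bits_of_cat ss1 ss2 : bits_of (ss1 ++ ss2) = bits_of ss1 ++ bits_of ss2.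
Proof. by rewrite /bits_of map_cat flatten_cat. Qed.

Lemma bits_of_rcons ss x : bits_of (rcons ss x) = bits_of ss ++ [:: x.1; x.2].
Proof. by rewrite -cats1 bits_of_cat. Qed.

Lemma bits_of_flatten sss : bits_of (flatten sss) = flatten (map bits_of sss).
Proof. by elim: sss => //= ss sss IH; rewrite bits_of_cat IH. Qed.

Lemma size_bits_of ss : size (bits_of ss) = 2 * size ss.
Proof. by elim: ss => //= x ss IH; rewrite mulnS IH. Qed.

Lemma nth_bits_of ss i : i < size ss ->
  (nth false (bits_of ss) (2 * i), nth false (bits_of ss) (2 * i).+1) =
  nth (false, false) ss i.
Proof. by elim: ss i => // -[a b] ss IH [//|i] lti; rewrite -[RHS]IH // mulnS. Qed.

Lemma enc_litE l : enc_lit l = bits_of (symbols_lit l).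
Proof.
rewrite /enc_lit /symbols_lit -rcons_cons bits_of_rcons; congr (_ ++ _).
by rewrite /bits_of -(map_cons (pair false)) -map_comp.
Qed.

Lemma enc_clauseE c : enc_clause c = bits_of (symbols_clause c).
Proof.
rewrite /enc_clause bits_of_rcons bits_of_flatten -map_comp.
by congr (flatten _ ++ _); apply: eq_map => l; apply: enc_litE.
Qed.

Lemma enc_cnfE phi : enc_cnf phi = bits_of (symbols_cnf phi).
Proof.
rewrite bits_of_flatten -map_comp.
by congr (flatten _); apply: eq_map => c; apply: enc_clauseE.
Qed.

Lemma binary1 : binary 1 = [:: true].
Proof. by rewrite /binary trunc_log1. Qed.

(** Reading one more digit doubles the number and adds the digit. It also follows that [j.*2] and
    [j.*2.+1] have numerals of the same length. *)
Lemma binary_double j (b : bool) : 0 < j ->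
  binary (b + j.*2) = rcons (binary j) b.
Proof.
move=> j0; rewrite /binary.
have -> : trunc_log 2 (b + j.*2) = (trunc_log 2 j).+1.
  rewrite trunc_log2S; last by case: b j0; case: j => //.
  by rewrite half_bit_double.
move: (trunc_log 2 j).+1 => k.
rewrite [in LHS]/mkseq /= rev_cons expn0 divn1 oddD odd_double addbF oddb.
congr (rcons (rev _) _).
rewrite /mkseq (iotaDl 1 0) -map_comp.
apply: eq_map => i /=; congr odd.
by rewrite add1n expnS divnMA divn2 half_bit_double.
Qed.

Lemma size_binary n : size (binary n) <= n.+1.
Proof.
rewrite size_rev size_mkseq ltnS.
case: n => [|n]; first by rewrite trunc_log0.
exact: ltnW (leq_trans (ltn_expl _ (ltnSn 1)) (trunc_logP _ _)).
Qed.

(* A literal occurrence, with the position of its first symbol. *)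
Notation occ := (nat * lit)%type.

(** [Sign] is kept apart from [Numeral] because the first digit has to be 1. Both remember the
    position and the sign of the unfinished literal. *)
Variant phase :=
  | Start
  | Sign of nat & bool
  | Numeral of nat & bool & nat.

Definition pstate := option (seq (seq occ) * seq occ * phase).

Definition parse_step (t : nat) (st : pstate) (x : symbol) : pstate :=
  if st is Some (done, cur, ph) then
    match ph, x with
    | Start, (false, s) => if size cur < 3 then Some (done, cur, Sign t s) else None
    | Start, (true, true) =>
      if 0 < size cur then Some (rcons done cur, [::], Start) else None
    | Sign p s, (false, true) => Some (done, cur, Numeral p s 1)
    | Numeral p s j, (false, b) => Some (done, cur, Numeral p s (b + j.*2))
    | Numeral p s j, (true, false) => Some (done, rcons cur (p, (j, s)), Start)
    | _, _ => None
    end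
  else None.

Fixpoint parse (t : nat) (st : pstate) (ss : seq symbol) : pstate :=
  if ss is x :: ss' then parse t.+1 (parse_step t st x) ss' else st.

Lemma parse_cat t st ss1 ss2 :
  parse t st (ss1 ++ ss2) = parse (t + size ss1) (parse t st ss1) ss2.
Proof.
elim: ss1 t st => [|x ss1 IH] t st; first by rewrite addn0.
by rewrite cat_cons /= IH addSnnS.
Qed.

Lemma parse_rcons t st ss x :
  parse t st (rcons ss x) = parse_step (t + size ss) (parse t st ss) x.
Proof. by rewrite -cats1 parse_cat. Qed.

Lemma parse_binary t done cur p s j : 0 < j ->
  parse t (Some (done, cur, Sign p s)) [seq (false, b) | b <- binary j] =
  Some (done, cur, Numeral p s j).
Proof.
elim/ltn_ind: j => -[|[|j]] // IH _.
rewrite -(odd_double_half j.+2) binary_double // map_rcons parse_rcons.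
by rewrite IH //= -?divn2; lia.
Qed.

Lemma parse_lit t done cur l : size cur < 3 -> 0 < l.1 ->
  parse t (Some (done, cur, Start)) (symbols_lit l) =
  Some (done, rcons cur (t, l), Start).
Proof.
case: l => j s ltcur j0; rewrite /symbols_lit /= ltcur parse_rcons.
by rewrite parse_binary.
Qed.

Lemma parse_lits t done cur c :
    size cur + size c <= 3 -> all (fun l : lit => 0 < l.1) c ->
  exists2 os : seq occ, map snd os = c &
    parse t (Some (done, cur, Start)) (flatten (map symbols_lit c)) =
    Some (done, cur ++ os, Start).
Proof.
elim: c t cur => [|l c IH] t cur; first by exists [::]; rewrite ?cats0.
have -> : flatten (map symbols_lit (l :: c)) =
  symbols_lit l ++ flatten (map symbols_lit c) by [].
rewrite parse_cat.
move=> lecur /andP[l0 c0]; rewrite parse_lit //; last by move: lecur;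
  rewrite [size (_ :: _)]/=; lia.
have [||os <- ->] := IH (t + size (symbols_lit l)) (rcons cur (t, l)).
- by rewrite size_rcons addSnnS.
- by [].
- by exists ((t, l) :: os) => //; rewrite cat_rcons.
Qed.

Lemma parse_cnf t done phi : is_3cnf phi ->
  exists2 oss : seq (seq occ), map (map snd) oss = phi &
    parse t (Some (done, [::], Start)) (symbols_cnf phi) =
    Some (done ++ oss, [::], Start).
Proof.
elim: phi t done => [|c phi IH] t done; first by exists [::]; rewrite ?cats0.
case/andP=> /andP[/andP[c_gt0 c_le3] c_pos] phi3.
have -> : symbols_cnf (c :: phi) = symbols_clause c ++ symbols_cnf phi by [].
rewrite parse_cat parse_rcons.
have [os osE ->] := @parse_lits t done [::] c c_le3 c_pos.
rewrite /= -[size os](size_map snd) osE c_gt0.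
have [oss ossE ->] := IH (t + size (symbols_clause c)) (rcons done os) phi3.
by exists (os :: oss); rewrite /= ?osE ?ossE // cat_rcons.
Qed.

Definition init_pstate : pstate := Some ([::], [::], Start).

(** The parser, with positions forgotten, is a left inverse of the encoding. *)
Lemma enc_cnf_inj phi psi : is_3cnf phi -> is_3cnf psi ->
  enc_cnf phi = enc_cnf psi -> phi = psi.
Proof.
move=> phi3 psi3; rewrite !enc_cnfE => eq_enc.
have eq_sym : symbols_cnf phi = symbols_cnf psi.
  have eq_size : size (symbols_cnf phi) = size (symbols_cnf psi).
    by apply/eqP; rewrite -(eqn_pmul2l (isT : 0 < 2)) -!size_bits_of eq_enc.
  apply: (@eq_from_nth _ (false, false)) => // i lti.
  by rewrite -!nth_bits_of ?eq_enc // -eq_size.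
have [oss ossE eq1] := @parse_cnf 0 [::] _ phi3.
have [oss' ossE' eq2] := @parse_cnf 0 [::] _ psi3.
by move: eq1; rewrite eq_sym eq2 -ossE -ossE' => -[->].
Qed.

Lemma SAT3_enc phi : is_3cnf phi -> SAT3 (enc_cnf phi) = `[< satisfiable phi >].
Proof.
move=> phi3; apply/asboolP/asboolP => [[psi [psi3 sat]]|sat]; last by exists phi.
by move/(enc_cnf_inj phi3 psi3) ->.
Qed.

(** * Soundness of the parser *)

Definition pending (ph : phase) : seq symbol :=
  match ph with
  | Start => [::]
  | Sign _ s => [:: (false, s)]
  | Numeral _ s j => (false, s) :: [seq (false, b) | b <- binary j]
  end.

Definition phase_start (t : nat) (ph : phase) : nat :=
  match ph with Start => t | Sign p _ | Numeral p _ _ => p end.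

Definition slice (x : nat -> symbol) p k := mkseq (fun i => x (p + i)) k.

Definition occ_ok (x : nat -> symbol) (t : nat) (o : occ) : bool :=
  (symbols_lit o.2 == slice x o.1 (size (symbols_lit o.2))) &&
  (o.1 + size (symbols_lit o.2) <= t).

Lemma occ_ok_leq x t t' o : t <= t' -> occ_ok x t o -> occ_ok x t' o.
Proof. by move=> let' /andP[oP leo]; rewrite /occ_ok oP (leq_trans leo). Qed.

(** This is the loop invariant of the parser, by induction on the prefix read. An unfinished literal
    already counts towards the limit of three, because the parser checks this limit at the sign. *)
Lemma parse_sound x t done cur ph :
    parse 0 init_pstate (mkseq x t) = Some (done, cur, ph) ->
  [/\ symbols_cnf (map (map snd) done) ++
        flatten (map symbols_lit (map snd cur)) ++ pending ph = mkseq x t,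
      is_3cnf (map (map snd) done),
      size cur + (pending ph != [::]) <= 3 /\ all (fun l : lit => 0 < l.1) (map
        snd cur),
      all (all (occ_ok x t)) done && all (occ_ok x t) cur
    & [/\ pending ph = slice x (phase_start t ph) (size (pending ph)),
          phase_start t ph + size (pending ph) = t
        & if ph is Numeral _ _ j then 0 < j else true]].
Proof.
elim: t done cur ph => [|t IH] done cur ph.
  by case=> <- <- <-; split.
rewrite mkseqS parse_rcons size_mkseq add0n.
case: (parse _ _ _) IH => [[[d c] q]|] // /(_ _ _ _ erefl).
case=> eq_enc d3 [c3 c_pos] /andP[d_ok c_ok] [q_eq q_sz q_pos].
have dS_ok : all (all (occ_ok x t.+1)) d.
  apply: sub_all d_ok => os; apply: sub_all => o.
  exact/occ_ok_leq/leqnSn.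
have cS_ok : all (occ_ok x t.+1) c.
  by apply: sub_all c_ok => o; apply/occ_ok_leq/leqnSn.
have qS : rcons (pending q) (x t) =
    slice x (phase_start t q) (size (pending q)).+1.
  by rewrite /slice mkseqS q_sz -/(slice _ _ _) -q_eq.
case: q eq_enc c3 q_eq q_sz q_pos qS => [|p s|p s j] eq_enc c3 q_eq q_sz q_pos qS /=;
  case xt: (x t) qS => [[] b] /= qS.
- case: b xt qS => // xt qS; case: ltnP => // c0 [<- <- <-]; split=> //.
  + rewrite -eq_enc map_rcons /symbols_cnf map_rcons flatten_rcons /= !cats0.
    by rewrite -rcons_cat.
  + by rewrite /is_3cnf map_rcons all_rcons -/(is_3cnf _) d3 andbT size_map c0
      -(addn0 (size c)) c3.
  + by rewrite all_rcons dS_ok cS_ok.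
  + by split=> //=; rewrite addn0.
- case: ltnP => // c_lt3 [<- <- <-]; split=> //.
  + by rewrite -eq_enc /= cats0 -cats1 catA.
  + by rewrite /= addn1.
  + by rewrite dS_ok cS_ok.
  + by split=> //=; rewrite addn1.
- by [].
- case: b xt qS => // xt qS [<- <- <-]; split=> //.
  + by rewrite -eq_enc /= ?binary1 -cats1 -!catA.
  + by rewrite dS_ok cS_ok.
  + by rewrite /= ?binary1; split=> //; rewrite -q_sz /= addnS.
- case: b xt qS => // xt qS [<- <- <-].
  split=> //.
  + rewrite -eq_enc map_rcons /= map_rcons flatten_rcons cats0.
    by rewrite !rcons_cat.
  + split; first by rewrite size_rcons addn0 -addn1.
    by rewrite map_rcons all_rcons q_pos.
  + rewrite dS_ok all_rcons cS_ok andbT /= /occ_ok /= /symbols_lit /= size_rcons.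
    by rewrite -/(slice _ _ _) qS eqxx /= addnS -q_sz.
  + by split=> //=; rewrite addn0.
- move=> [<- <- <-]; rewrite /= in q_pos; split=> //.
  + by rewrite -eq_enc /= binary_double // map_rcons !rcons_cat.
  + by rewrite dS_ok cS_ok.
  + rewrite /= binary_double // map_rcons size_rcons; split=> //.
    * by rewrite -q_sz addnS.
    * by lia.
Qed.

(** * From circuits for 3SAT to instruction sequences for 3SATC *)

Section Enumeration.

Variable alpha : nat -> nat -> {fset lit}.
Hypothesis alphaP : is_enumeration alpha.

Lemma alpha_clause k i : 0 < i <= nd k -> clause_set k (alpha k i).
Proof. by case: (alpha_bij alphaP k) => homo _ _ i_le; apply: (homo i). Qed.

Lemma alpha_surj k L : clause_set k L ->
  exists2 i, 0 < i <= nd k & alpha k i = L.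
Proof. by case: (alpha_bij alphaP k) => _ _ surj /surj[i]; exists i. Qed.

Lemma selected_take k w : selected alpha k (take (nd k) w) = selected alpha k w.
Proof.
congr map; apply: eq_in_filter => i; rewrite mem_iota => /andP[i0 ltik].
by rewrite nth_take // -ltnS prednK // -add1n.
Qed.

(* The clauses that are not selected are replaced by trivially satisfiable
   ones, using fresh variables with numerals of the same length, so that the
   length of the encoding does not depend on the selection. *)
Definition pad_lit (b : bool) (l : lit) : lit :=
  if b then (l.1.*2, l.2) else (l.1.*2.+1, true).

Definition pad_clause (k i : nat) (b : bool) : seq lit :=
  map (pad_lit b) (enum_fset (alpha k i)).

Definition padded (k : nat) (w : seq bool) : seq (seq lit) :=
  [seq pad_clause k i (nth false w i.-1) | i <- iota 1 (nd k)].

Lemma padded_3cnf k w : is_3cnf (padded k w).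
Proof.
apply/allP => c /mapP[i]; rewrite mem_iota add1n ltnS => /alpha_clause[pos card] ->.
rewrite size_map card /= all_map; apply/allP => l /pos /andP[l0 _] /=.
by case: (nth _ _ _) => //=; rewrite double_gt0.
Qed.

(** The even variables carry the original assignment. Making all odd variables true satisfies every
    padding clause. *)
Lemma satisfiable_padded k w :
  satisfiable (padded k w) <-> satisfiable (selected alpha k w).
Proof.
split=> [[v /allP vP]|[v /allP vP]].
  exists (fun j => v j.*2); apply/allP => c /mapP[i].
  rewrite mem_filter => /andP[wi i_in] ->.
  have /vP : pad_clause k i (nth false w i.-1) \in padded k w by apply: map_f.
  by rewrite wi has_map => /hasP[l lL vl]; apply/hasP; exists l.
exists (fun j => if odd j then true else v j./2).
apply/allP => c /mapP[i i_in ->]; rewrite has_map.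
case wi: (nth false w i.-1).
  have /vP/hasP[l lL vl] : enum_fset (alpha k i) \in selected alpha k w.
    by apply/mapP; exists i => //; rewrite mem_filter wi.
  by apply/hasP; exists l => //; rewrite /lit_holds /= odd_double doubleK.
(* A clause that is not selected is nonempty, so its padding contains a true literal. *)
move: i_in; rewrite mem_iota add1n ltnS => /alpha_clause[_].
case: (enum_fset _) => //= l s _.
by rewrite /lit_holds /= odd_double.
Qed.

(** The numerals of [j.*2] and [j.*2.+1] differ only in their last digit; for [j = 0] both consist
    of a single digit. *)
Lemma size_pad_clause k i b :
  size (enc_clause (pad_clause k i b)) = size (enc_clause (pad_clause k i true)).
Proof.
rewrite !enc_clauseE !size_bits_of !size_rcons; congr (2 * _.+1).
rewrite !size_flatten /shape -!map_comp; congr sumn; apply: eq_map => l.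
case: b => //=; rewrite !size_rcons !size_map; congr _.+2.
case: l => -[|j] s; first by [].
move=> /=.
by rewrite -[_.*2.+1]/(true + _) -[_.*2 in RHS]/(false + _) !binary_double //
  !size_rcons.
Qed.

Lemma size_enc_padded k w : size (enc_cnf (padded k w)) = size (enc_cnf (padded k
  [::])).
Proof.
rewrite /enc_cnf /padded -!map_comp !size_flatten /shape -!map_comp.
by congr sumn; apply: eq_map => i /=; rewrite size_pad_clause [RHS]size_pad_clause.
Qed.

(** As block lengths do not depend on [w], position [p] always falls into the same block, and the
    content of that block is governed by one bit of [w]. *)
Lemma bitwise_flatten n (I : seq nat) (G : nat -> bool -> seq bool) :
    (forall i, i \in I -> i.-1 < n) ->
    (forall i b, size (G i b) = size (G i true)) ->
  bitwise n (fun w => flatten [seq G i (nth false w i.-1) | i <- I]).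
Proof.
move=> In szG; elim: I In => [|i I IH] In p.
  by exists 0, false, false; split=> [|w]; [right | rewrite nth_nil if_same].
have [ltp|lep] := ltnP p (size (G i true)).
  exists i.-1, (nth false (G i true) p), (nth false (G i false) p); split.
    by left; apply: In; apply: mem_head.
  by move=> w /=; rewrite nth_cat szG ltp; case: ifP.
have [|j [c1 [c0 [ltj jP]]]] := IH _ (p - size (G i true)).
  by move=> j jI; apply: In; rewrite inE jI orbT.
by exists j, c1, c0; split=> // w /=; rewrite nth_cat szG ltnNge lep -jP.
Qed.

Lemma bitwise_padded n k : nd k <= n -> bitwise n (fun w => enc_cnf (padded k w)).
Proof.
move=> le_n.
have -> : (fun w => enc_cnf (padded k w)) =
    fun w => flatten [seq enc_clause (pad_clause k i (nth false w i.-1)) | i <-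
      iota 1 (nd k)].
  by apply: funext => w; rewrite /enc_cnf -map_comp.
apply: (@bitwise_flatten _ _ (fun i b => enc_clause (pad_clause k i b))) => [i|i b].
  by rewrite mem_iota add1n ltnS => /andP[i0 /leq_trans/(_ le_n)]; rewrite prednK.
exact: size_pad_clause.
Qed.

Lemma size_flatten_le (T : Type) (ss : seq (seq T)) B :
  all (fun s => size s <= B) ss -> size (flatten ss) <= size ss * B.
Proof.
by elim: ss => //= s ss IH /andP[les /IH]; rewrite size_cat mulSn; apply: leq_add.
Qed.

(** Each literal takes a sign, a comma and at most [2 * k + 2] digits. A clause has at most three
    literals and a semicolon, and every symbol takes two bits. *)
Lemma size_enc_padded_le k w :
  size (enc_cnf (padded k w)) <= nd k * (2 * (3 * (2 * k + 4)).+1).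
Proof.
have -> : nd k = size (map enc_clause (padded k w)) by rewrite !size_map size_iota.
apply: size_flatten_le; rewrite all_map; apply/allP => c /mapP[i].
rewrite mem_iota add1n ltnS => /alpha_clause[pos /andP[_ card]] ->.
rewrite /= enc_clauseE size_bits_of size_rcons leq_mul2l /= ltnS.
apply: leq_trans (@size_flatten_le _ _ (2 * k + 4) _) _; last first.
  by rewrite !size_map leq_mul2r card orbT.
rewrite !all_map; apply/allP => l /pos /andP[_ lek] /=.
rewrite size_rcons size_map addn4 mul2n !ltnS (leq_trans (size_binary _)) //.
by case: (nth _ _ _); rewrite /= ltnS ?ltnS ?leq_double // ltnW // ltnS leq_double.
Qed.

Lemma P_IS_of_P_poly : P_poly SAT3 -> P_IS (SATC3 alpha).
Proof.
case=> h hP; pose m n := n * (2 * (3 * (2 * n + 4)).+1).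
have [g gP] : poly_bounded (fun n => 4 * h.[m n]%R + 3).
  by rewrite /m; poly_bound.
exists g => n; set k := stage n.
have /andP[le_ndk _] := stageP n; rewrite -/k in le_ndk.
(* One circuit serves all inputs of length [n], since the length of the padded encoding depends on
   [k] only. *)
have [C [wfC evalC szC]] := hP (size (enc_cnf (padded k [::]))).
have [X [brX compX szX]] := computes_circuit (bitwise_padded le_ndk) wfC.
exists X; split=> //; last first.
  apply: leq_trans szX (leq_trans _ (gP n)); rewrite leq_add2r leq_mul2l /=.
  apply: leq_trans szC (horner_nat_mono _ (leq_trans (size_enc_padded_le _ _) _)).
  have lekn : k <= n := leq_trans (nd_ge k) le_ndk.
  by apply: leq_mul => //; rewrite leq_mul2l ltnS leq_mul2l leq_add2r leq_mul2l.
move=> b; have [s ex eqs] := compX b; exists s => //; rewrite eqs.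
have sz : size (enc_cnf (padded k b)) == size (enc_cnf (padded k [::])).
  by rewrite size_enc_padded.
rewrite (evalC (Tuple sz)) /= SAT3_enc ?padded_3cnf // /SATC3 size_tuple -/k.
rewrite selected_take; apply: asbool_equiv_eq; exact: satisfiable_padded.
Qed.

End Enumeration.

(** * Recognizing clauses and conflicting literals *)

Lemma binary_inj j k : 0 < j -> 0 < k -> binary j = binary k -> j = k.
Proof.
move=> j0 k0 eqb; have := @parse_binary 0 [::] [::] 0 true _ j0.
by rewrite eqb parse_binary // => -[].
Qed.

Lemma occ_nth x t (o : occ) i : occ_ok x t o -> i < size (symbols_lit o.2) ->
  x (o.1 + i) = nth (false, false) (symbols_lit o.2) i.
Proof. by case/andP=> /eqP -> _; rewrite size_mkseq => lti; rewrite nth_mkseq. Qed.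

Section OccSymbols.

Variables (x : nat -> symbol) (t p : nat) (l : lit).
Hypothesis ok : occ_ok x t (p, l).

Lemma size_symbols_lit : size (symbols_lit l) = (size (binary l.1)).+2.
Proof. by rewrite /= size_rcons size_map. Qed.

Lemma occ_sign : x p = (false, l.2).
Proof. by rewrite -[p]addn0 (occ_nth ok). Qed.

Lemma occ_digit i : i < size (binary l.1) ->
  x (p + i.+1) = (false, nth false (binary l.1) i).
Proof.
move=> lti; rewrite (occ_nth ok) ?size_symbols_lit ?ltnS; last exact: ltnW.
by rewrite /= nth_rcons size_map lti (nth_map false).
Qed.

Lemma occ_comma : x (p + (size (binary l.1)).+1) = (true, false).
Proof.
rewrite (occ_nth ok) ?size_symbols_lit //=.
by rewrite nth_rcons size_map ltnn eqxx.
Qed.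

End OccSymbols.

(* Meaningful only when literals start at positions [p] and [q]. *)
Definition conflict (M : nat) (x : nat -> symbol) (p q : nat) : bool :=
  ((x p).2 != (x q).2) &&
  has (fun d => (x (p + d) == (true, false)) &&
                all (fun e => x (p + e) == x (q + e)) (iota 1 d)) (iota 1 M).

(** Agreement up to and including a comma forces equal numerals, because a comma is never a digit.
    The comma found may belong to a later literal, but then the agreement covers the first one as
    well. *)
Lemma conflict_occ M x p q (l l' : lit) : 0 < l.1 -> 0 < l'.1 ->
    occ_ok x M (p, l) -> occ_ok x M (q, l') ->
  conflict M x p q = (l.2 != l'.2) && (l.1 == l'.1).
Proof.
move=> l0 l'0 ok ok'; rewrite /conflict (occ_sign ok) (occ_sign ok') /=.
congr (_ && _); set a := size (binary l.1).
apply/hasP/eqP => [[d _ /andP[/eqP xd /allP eqx]]|eql].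
  have {}eqx e : 0 < e -> e <= d -> x (p + e) = x (q + e).
    by move=> e0 lee; apply/eqP/eqx; rewrite mem_iota e0 add1n ltnS.
  have ltad : a < d.
    rewrite ltnNge; apply/negP; case: d xd eqx => [|d] xd eqx led.
      by move: xd; rewrite addn0 (occ_sign ok).
    by move: xd; rewrite (occ_digit ok).
  (* With different lengths, the comma of the shorter numeral would face a digit of the longer
     one. *)
  have eqa : a = size (binary l'.1).
    case: (ltngtP a (size (binary l'.1))) => // lta.
      have := occ_comma ok; rewrite -/a eqx // (occ_digit ok' lta).
      by [].
    have := occ_comma ok'; rewrite -eqx //; last exact: leq_trans lta (ltnW ltad).
    by rewrite (occ_digit ok lta).
  apply: binary_inj => //; apply: (@eq_from_nth _ false) => // i lti.
  have := eqx i.+1 isT (ltn_trans lti ltad).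
  by rewrite (occ_digit ok) // (occ_digit ok') -?eqa // => -[].
(* The comma of the first literal stands [a.+1] places after its sign, still within the first [M]
   symbols. *)
exists a.+1.
  case/andP: ok => _; rewrite size_symbols_lit -/a mem_iota /= => leM.
  by rewrite ltnS -ltnS; lia.
rewrite (occ_comma ok) eqxx; apply/allP => -[|e]; rewrite mem_iota // add1n !ltnS => /=.
rewrite leq_eqVlt => /orP[/eqP ->|lte].
  by rewrite (occ_comma ok) /a eql (occ_comma ok').
by rewrite (occ_digit ok) // (occ_digit ok') -?eql.
Qed.

(* The part of a parser state that a finite automaton can track when it knows
   the set [P] of positions: how many literals the current clause has (in
   unary), the phase, whether all of them start in [P], and whether this was
   the case for some earlier clause. *)
Notation fstate :=
  (option ((bool * bool * bool) * (bool * bool) * (bool * bool)))%type.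

Definition abstract (P : pred nat) (st : pstate) : fstate :=
  if st is Some (done, cur, ph) then
    Some ((0 < size cur, 1 < size cur, 2 < size cur),
          match ph with
          | Start => (false, false)
          | Sign _ _ => (true, false)
          | Numeral _ _ _ => (false, true)
          end,
          (all (fun o : occ => P o.1) cur &&
             (if ph is (Sign p _ | Numeral p _ _) then P p else true),
           has (all (fun o : occ => P o.1)) done))
  else None.

Definition abstract_step (P : pred nat) (t : nat) (q : fstate) (x : symbol) : fstate :=
  if q is Some ((c1, c2, c3), (sign, numeral), (ok, found)) then
    if sign then
      if x == (false, true) then Some ((c1, c2, c3), (false, true), (ok, found))
      else None
    else if numeral then
      if ~~ x.1 then q
      else if x.2 then None
      else Some ((true, c1, c2), (false, false), (ok, found))
    else if ~~ x.1 then
      if c3 then None else Some ((c1, c2, c3), (true, false), (ok && P t, found))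
    else if x.2 && c1 then
      Some ((false, false, false), (false, false), (true, ok || found))
    else None
  else None.

(** The set [P] is consulted only when a sign is read, and at that moment [t] is the position where
    the literal starts. *)
Lemma abstract_parse_step P t st x :
  abstract P (parse_step t st x) = abstract_step P t (abstract P st) x.
Proof.
case: st => [[[done cur] ph]|] //.
case: ph => [|p s|p s j]; case: x => -[] [] //=.
- by case: (0 < size cur) => //=; rewrite has_rcons andbT.
- by case: ltnP => [lt3|] //=; rewrite andbT (ltnNge 2) (lt3 : size cur <= 2).
- by case: ltnP => [lt3|] //=; rewrite andbT (ltnNge 2) (lt3 : size cur <= 2).
- by rewrite size_rcons all_rcons /= andbT andbC.
Qed.

(** * The clauses selected by an input string *)

Definition symbol_at (w : seq bool) (t : nat) : symbol :=
  (nth false w (2 * t), nth false w (2 * t).+1).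

Definition parsed (M : nat) (w : seq bool) : pstate :=
  parse 0 init_pstate (mkseq (symbol_at w) M).

Definition accepts (M : nat) (w : seq bool) : bool :=
  if parsed M w is Some (_, [::], Start) then true else false.

Definition covers (P : pred nat) (M : nat) (w : seq bool) : bool :=
  if parsed M w is Some (done, _, _) then has (all (fun o : occ => P o.1)) done
  else false.

Definition negatives (L : {fset lit}) : seq nat :=
  [seq l.1.-1 | l : lit <- enum_fset L & ~~ l.2].

(* Variable [p + 1] stands for the truth of the literal starting at symbol
   [p].  Clauses of the input become positive clauses in these variables, and
   complementary literals exclude each other.  Any superset of such a clause
   may be selected too. *)
Definition clause_bit (M : nat) (L : {fset lit}) (w : seq bool) : bool :=
  covers (fun p => (p.+1, true) \in L) M w ||
  has (fun pq => conflict M (symbol_at w) pq.1 pq.2)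
    [seq (p, q) | p <- negatives L, q <- negatives L].

Lemma symbols_of_bits phi w M : size w = 2 * M -> w = bits_of (symbols_cnf phi) ->
  mkseq (symbol_at w) M = symbols_cnf phi.
Proof.
move=> szw wE; have szM : size (symbols_cnf phi) = M.
  by apply/eqP; rewrite -(eqn_pmul2l (isT : 0 < 2)) -size_bits_of -wE szw.
apply: (@eq_from_nth _ (false, false)); rewrite size_mkseq // => i lti.
by rewrite nth_mkseq // /symbol_at wE nth_bits_of // szM.
Qed.

Lemma bits_of_symbols w M : size w = 2 * M ->
  bits_of (mkseq (symbol_at w) M) = w.
Proof.
elim: M w => [|M IH] w; first by rewrite muln0 => /size0nil ->.
rewrite mulnS; case: w => [|a [|b w]] // [szw].
rewrite -[in RHS](IH w szw) /mkseq /= (iotaDl 1 0) -map_comp.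
rewrite /bits_of /= /symbol_at /=; congr [:: _, _ & flatten (map _ _)].
apply: eq_map => i; rewrite -[LHS]/(symbol_at [:: a, b & w] (1 + i)).
by rewrite /symbol_at add1n mulnS.
Qed.

Lemma SAT3_accepts w M : size w = 2 * M -> SAT3 w -> accepts M w.
Proof.
move=> szw /asboolP[phi [phi3 _ wE]]; rewrite enc_cnfE in wE.
rewrite /accepts /parsed (symbols_of_bits szw wE).
by have [oss _ ->] := @parse_cnf 0 [::] _ phi3.
Qed.

Lemma acceptsP w M : size w = 2 * M -> accepts M w ->
  exists oss : seq (seq occ), let phi := map (map snd) oss in
  [/\ parsed M w = Some (oss, [::], Start), is_3cnf phi, w = enc_cnf phi
    & all (all (occ_ok (symbol_at w) M)) oss].
Proof.
move=> szw; rewrite /accepts; case e: (parsed M w) => [[[oss [|//]] []]|] // _.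
exists oss; have [eq_enc phi3 _ /andP[ok _] _] := parse_sound e.
rewrite /= cats0 in eq_enc.
by split=> //; rewrite enc_cnfE eq_enc bits_of_symbols.
Qed.

(** Assignments are translated between the variables of the formula and its literal occurrences.
    [M <= K] makes every position [p < M] available as the variable [p.+1]. *)
Lemma satisfiable_clause_bit w M K : size w = 2 * M -> M <= K -> accepts M w ->
  (exists v, forall L, clause_set K L -> clause_bit M L w ->
     has (lit_holds v) (enum_fset L)) <-> SAT3 w.
Proof.
move=> szw leMK /(acceptsP szw)[oss [parsE phi3 wE ok]].
set phi := map _ oss in phi3 wE.
rewrite {2}wE SAT3_enc //; set x := symbol_at w.
have occP o os : os \in oss -> o \in os -> 0 < o.2.1 /\ occ_ok x M o.
  move=> os_in o_in; split; last exact: (allP (allP ok _ os_in)).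
  have /(allP phi3)/andP[_ /allP] : map snd os \in phi by apply: map_f.
  by apply; apply: map_f.
have occ_lt o os : os \in oss -> o \in os -> o.1.+1 <= K.
  move=> os_in o_in; have [_ /andP[_]] := occP _ _ os_in o_in.
  move=> leM; apply: leq_trans leMK; apply: leq_trans leM.
  by rewrite size_symbols_lit addnS ltnS leq_addr.
split=> [[v vP]|/asboolP[v /allP vP]].
  (* A variable is made true iff one of its positive occurrences is marked true by [v]. *)
  apply/asboolP; pose holds_at j := fun o : occ => (o.2 == (j, true)) && v o.1.+1.
  exists (fun j => has (holds_at j) (flatten oss)).
  apply/allP => c /mapP[os os_in ->]; rewrite has_map.
  have /(allP phi3)/andP[sz_os _] : map snd os \in phi by apply: map_f.
  rewrite size_map in sz_os.
  pose L := [fset l in [seq (o.1.+1, true) | o : occ <- os]]%fset : {fset lit}.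
  have LE l : (l \in L) = (l \in [seq (o.1.+1, true) | o : occ <- os]).
    by rewrite in_fset.
  have clL : clause_set K L.
    split=> [l|].
      by rewrite LE => /mapP[o o_in ->] /=; apply: occ_lt o_in.
    rewrite card_fseq; case: (os) sz_os => // o os1 /andP[_ le3]; apply/andP; split.
      by rewrite lt0n size_eq0; apply/eqP => /undup_nil.
    by apply: leq_trans (size_undup _) _; rewrite size_map.
  have : clause_bit M L w.
    apply/orP; left; rewrite /covers parsE; apply/hasP; exists os => //.
    by apply/allP => o o_in; rewrite LE; apply: map_f.
  move/(vP _ clL)/hasP => [l lL]; move: lL; rewrite -/(l \in L) LE.
  case/mapP=> o o_in -> /eqP /= vo; apply/hasP; exists o => //=.
  case ol: o.2 => [j [|]]; rewrite /lit_holds /=.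
    apply/eqP/hasP; exists o; last by rewrite /holds_at ol eqxx vo.
    by apply/flattenP; exists os.
  (* For a marked negative occurrence, a marked positive occurrence of the same variable would
     violate the selected clause [L']. *)
  apply/eqP/negbTE/hasPn => o' /flattenP[os' os'_in o'_in].
  apply/negP => /andP[/eqP o'l vo'].
  pose L' := [fset (o.1.+1, false); (o'.1.+1, false)]%fset : {fset lit}.
  have clL' : clause_set K L'.
    split=> [a|].
      rewrite !inE => /orP[] /eqP -> /=; first exact: occ_lt o_in.
      exact: occ_lt o'_in.
    by rewrite cardfs2; case: (_ != _).
  have : clause_bit M L' w.
    apply/orP; right; apply/hasP; exists (o.1, o'.1).
      apply/allpairsP; exists (o.1, o'.1); split=> //; apply/mapP.
        by exists (o.1.+1, false) => //; rewrite mem_filter /= !inE eqxx.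
      by exists (o'.1.+1, false) => //; rewrite mem_filter /= !inE eqxx orbT.
    have [o0 oko] := occP _ _ os_in o_in; have [o'0 oko'] := occP _ _ os'_in o'_in.
    case: o o' ol o'l o0 o'0 oko oko' {vo vo' o_in o'_in L' clL'} => r k [r' k']
      /= -> -> ? ? oko oko'.
    by rewrite (conflict_occ _ _ oko oko') //= eqxx.
  move/(vP _ clL')/hasP => [a]; rewrite -/(a \in L') !inE => /orP[] /eqP -> /eqP /=.
    by rewrite vo.
  by rewrite vo'.
(* Conversely, the variable [p.+1] is made true iff a literal starts at [p] and holds under [v]. *)
pose u a := has (fun o : occ => (o.1.+1 == a) && lit_holds v o.2) (flatten oss).
exists u => L clL /orP[|/hasP[_ /allpairsP[[p q] /= [pL qL ->]] /= cpq]].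
  rewrite /covers parsE => /hasP[os os_in /allP osL].
  have /vP : map snd os \in phi by apply: map_f.
  rewrite has_map => /hasP[o o_in vo]; apply/hasP; exists (o.1.+1, true);
    first exact: osL.
  apply/eqP/hasP; exists o; last by rewrite eqxx.
  by apply/flattenP; exists os.
case/mapP: pL => l; rewrite mem_filter => /andP[negl lL] eqp.
case/mapP: qL => l'; rewrite mem_filter => /andP[negl' l'L] eqq.
have [/(_ l lL)/andP[l0 _] _] := clL; have [/(_ l' l'L)/andP[l'0 _] _] := clL.
(* If both negative literals fail, then the occurrences at [p] and [q] both hold under [v], contrary
   to their being complementary. *)
case ul: (u l.1); last by apply/hasP; exists l => //;
  rewrite /lit_holds ul (negbTE negl).
case ul': (u l'.1); last by apply/hasP; exists l' => //;
  rewrite /lit_holds ul' (negbTE negl').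
case/hasP: ul => o /flattenP[os os_in o_in] /andP[/eqP eqo vo].
case/hasP: ul' => o' /flattenP[os' os'_in o'_in] /andP[/eqP eqo' vo'].
have [o0 oko] := occP _ _ os_in o_in; have [o'0 oko'] := occP _ _ os'_in o'_in.
move: cpq; rewrite eqp eqq -eqo -eqo' /=.
case: o o' o0 o'0 oko oko' vo vo' {o_in o'_in eqo eqo'} => r k [r' k'] /= ? ? oko oko'.
rewrite (conflict_occ _ _ oko oko') // /lit_holds => /eqP vk /eqP vk' /andP[/eqP
  ne /eqP eqk].
by case: ne; rewrite -vk -vk' eqk.
Qed.

(** * From instruction sequences for 3SATC to circuits for 3SAT *)

Section Costs.

Variables (n M : nat) (S : (seq bool -> bool) -> Prop).

Lemma derivable_symbol t a : derivable n S 19 (fun w => symbol_at w t == a).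
Proof.
have bitP i b : derivable n S 9 (fun w => nth false w i == b).
  exact: derivable_eq (derivable_nth n S i) (derivable_const n S b).
apply: derivable_ext (derivable_and (bitP (2 * t) a.1) (bitP (2 * t).+1 a.2)).
by move=> w _; case: a.
Qed.

(** There are [M] candidates for the comma, each needing at most [M] comparisons of symbols at cost
    19. *)
Definition conflict_cost := 12 + M * (M * 20 + 22).

Lemma derivable_conflict p q :
  derivable n S conflict_cost (fun w => conflict M (symbol_at w) p q).
Proof.
have bitP i j : derivable n S 9 (fun w => nth false w i == nth false w j).
  exact: derivable_eq (derivable_nth n S i) (derivable_nth n S j).
have symP i j : derivable n S 19 (fun w => symbol_at w i == symbol_at w j).
  exact: derivable_and (bitP _ _) (bitP _ _).
pose G d w := (symbol_at w (p + d) == (true, false)) &&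
  all (fun e => symbol_at w (p + e) == symbol_at w (q + e)) (iota 1 d).
have GP d : d \in iota 1 M -> derivable n S (M * 20 + 21) (G d).
  rewrite mem_iota add1n ltnS => /andP[_ led].
  have allP := @derivable_all n _ S 19 (iota 1 d)
    (fun e w => symbol_at w (p + e) == symbol_at w (q + e)) (fun e _ => symP _ _).
  apply: derivable_le (derivable_and (derivable_symbol (p + d) _) allP).
  by rewrite size_iota; lia.
apply: derivable_le (derivable_and
  (derivable_not (bitP (2 * p).+1 (2 * q).+1)) (derivable_has GP)).
by rewrite size_iota /conflict_cost -addnS; lia.
Qed.

(** This is the bound of [derivable_scan] for symbol tests of cost 19. It is linear in [M], as the
    state and symbol types are fixed. *)
Definition scan_cost :=
  M.+1 * (#|{: fstate}| * (#|{: fstate * symbol}| * 23).+1) +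
  (#|{: fstate}| * 3).+1.

Lemma derivable_abstract (P : pred nat) (Q : pred fstate) :
  derivable n S scan_cost (fun w => Q (abstract P (parsed M w))).
Proof.
apply: (@derivable_scan n S 19 _ _ (fun t w => symbol_at w t) (abstract_step P)
  (fun t w => abstract P (parsed t w)) M Q (abstract P init_pstate)) => //
  [t a _|t w _ _].
  exact: derivable_symbol.
by rewrite /parsed mkseqS parse_rcons size_mkseq abstract_parse_step.
Qed.

Lemma derivable_covers P : derivable n S scan_cost (covers P M).
Proof.
pose Q (q : fstate) := if q is Some (_, (_, found)) then found else false.
apply: derivable_ext (derivable_abstract P Q) => w _.
by rewrite /covers; case: (parsed M w) => [[[]]|].
Qed.

Lemma derivable_accepts : derivable n S scan_cost (accepts M).
Proof.
pose Q (q : fstate) :=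
  if q is Some ((false, _, _), (false, false), _) then true else false.
apply: derivable_ext (derivable_abstract pred0 Q) => w _.
by rewrite /accepts; case: (parsed M w) => [[[? []] []]|].
Qed.

(** A clause has at most three negative literals, hence at most nine pairs to test for conflict. *)
Definition clause_bit_cost := scan_cost + 9 * conflict_cost.+1 + 2.

Lemma derivable_clause_bit K L : clause_set K L ->
  derivable n S clause_bit_cost (clause_bit M L).
Proof.
case=> _ /andP[_ card_L].
apply: derivable_le (derivable_or (derivable_covers _)
  (@derivable_has n _ S conflict_cost _
     (fun pq w => conflict M (symbol_at w) pq.1 pq.2) _)) => [|pq _].
- rewrite /clause_bit_cost addn2 !ltnS addnS ltnS leq_add2l leq_mul2r; apply/orP; right.
  have le3 : size (negatives L) <= 3.
    rewrite size_map size_filter; exact: leq_trans (count_size _ _) card_L.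
  by rewrite size_allpairs; apply: (leq_mul le3 le3).
- exact: derivable_conflict.
Qed.

End Costs.

Lemma conflict_cost_leq : {homo conflict_cost : M N / M <= N}.
Proof.
by move=> M N le; rewrite leq_add2l leq_mul // leq_add2r leq_mul.
Qed.

Lemma scan_cost_leq : {homo scan_cost : M N / M <= N}.
Proof. by move=> M N le; rewrite leq_add2r leq_mul. Qed.

Lemma clause_bit_cost_leq : {homo clause_bit_cost : M N / M <= N}.
Proof.
move=> M N le; rewrite leq_add2r leq_add ?scan_cost_leq //.
by rewrite leq_mul // ltnS conflict_cost_leq.
Qed.

Lemma nd_ltn k : nd k < nd k.+1.
Proof.
have lt2 : 2 * k < 2 * k.+1 by rewrite ltn_pmul2l.
have leC m : 'C(2 * k, m) <= 'C(2 * k.+1, m) by apply: leq_bin2l; apply: ltnW.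
rewrite /nd (bin1 (2 * k)) (bin1 (2 * k.+1)) -!addSn.
exact: leq_add (leq_add lt2 (leC 2)) (leC 3).
Qed.

Lemma nd_leq : {homo nd : j k / j <= k}.
Proof. by apply: homo_leq => // [k|k]; [apply: leq_trans | apply/ltnW/nd_ltn]. Qed.

Lemma stage_nd k : stage (nd k) = k.
Proof.
have /andP[le_nd lt_nd] := stageP (nd k).
case: (ltngtP (stage (nd k)) k) => // [/nd_leq|/nd_leq] le.
  by rewrite leqNgt lt_nd in le.
by have := leq_trans (nd_ltn k) (leq_trans le le_nd); rewrite ltnn.
Qed.

(** By Pascal's rule. It makes [nd] polynomially bounded. *)
Lemma leq_bin_expn m k : 'C(m, k) <= m ^ k.
Proof.
elim: m k => [|m IH] [|k] //.
rewrite binS; apply: leq_trans (leq_add (IH _) (IH _)) _.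
rewrite !expnS -mulSnr; apply: leq_mul => //.
by case: k => // k; rewrite leq_exp2r.
Qed.

Section Reduction.

Variable alpha : nat -> nat -> {fset lit}.
Hypothesis alphaP : is_enumeration alpha.

(** Clauses are numbered from 1 and list entries from 0, whence [i.+1]. *)
Definition clause_bits (M K : nat) (w : seq bool) : seq bool :=
  mkseq (fun i => clause_bit M (alpha K i.+1) w) (nd K).

Lemma SATC3_clause_bits M K w : size w = 2 * M -> M <= K -> accepts M w ->
  SATC3 alpha (clause_bits M K w) = SAT3 w.
Proof.
move=> szw leMK acc; apply/asboolP/idP; rewrite size_mkseq stage_nd selected_take.
  case=> v /allP vP; apply/(satisfiable_clause_bit szw leMK acc).
  exists v => L /(alpha_surj alphaP)[i /andP[i0 lei] <-] bitL.
  apply: vP; apply: map_f; rewrite mem_filter mem_iota add1n ltnS i0 lei !andbT.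
  by rewrite /clause_bits nth_mkseq prednK.
case/(satisfiable_clause_bit szw leMK acc) => v vP; exists v.
apply/allP => c /mapP[i]; rewrite mem_filter mem_iota add1n ltnS.
case/andP=> bit_i /andP[i0 lei] ->; apply: vP; first by apply: alpha_clause;
  rewrite ?i0.
by move: bit_i; rewrite /clause_bits nth_mkseq prednK.
Qed.

Lemma P_poly_of_P_IS : P_IS (SATC3 alpha) -> P_poly SAT3.
Proof.
case=> h hP.
(* With [d = 2 * m], the argument of [h] is [d + d ^ 2 + d ^ 3], which bounds [nd m]. *)
pose X_bound m := h.[(let d := 2 * m in d + (d * d + d * (d * d)))%N]%R.
pose cost m b := (b.+1 * ((b + b.+1) * (clause_bit_cost m + 10)) + scan_cost m + 4).
have [g gP] : poly_bounded (fun m => cost m (X_bound m)).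
  rewrite /cost /X_bound /clause_bit_cost /scan_cost /conflict_cost.
  by poly_bound.
exists g => m; set M := m./2.
have leMm : M <= m by rewrite /M -divn2 leq_div.
(* The input of length [m] has at most [M <= m] literal positions, so level [m] of the enumeration
   offers enough variables. *)
have [X [brX compX szX]] := hP (nd m).
have szX' : size X <= X_bound m.
  apply: leq_trans szX (horner_nat_mono _ _).
  by rewrite /nd -addnA bin1 leq_add2l; apply: leq_add; apply: leq_bin_expn.
pose out w := (sweep X (0, init_regs (clause_bits M m w)) 0 (size X)).2 Out.
have outE w : out w = SATC3 alpha (clause_bits M m w).
  have sz : size (clause_bits M m w) == nd m by rewrite size_mkseq.
  have [s /exec_sweep] := compX (Tuple sz).
  by rewrite subn0 /out => ->.
have bitP i : derivable m (fun=> False) (clause_bit_cost M)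
    (fun w => nth false (clause_bits M m w) i).
  have [lti|lei] := ltnP i (nd m).
    apply: derivable_ext (derivable_clause_bit _ _ _ (alpha_clause alphaP (k :=
      m) (i := i.+1) _)) => //.
    by move=> w _; rewrite nth_mkseq.
  apply: derivable_le (derivable_ext _ (derivable_const _ _ false)).
    by rewrite /clause_bit_cost addn2.
  by move=> w _; rewrite nth_default // size_mkseq.
(* Only strings of even length that pass the syntax check are handed to the simulated instruction
   sequence; 3SAT contains no others. *)
pose F w := ~~ odd m && (accepts M w && out w).
have FP : derivable m (fun=> False) _ F := derivable_and (derivable_const _ _ _)
  (derivable_and (derivable_accepts m M _) (derivable_sweep X bitP)).
have [C [wfC evalC szC]] := circuit_of_derivable FP.
exists C; split=> //; last first.
  apply: leq_trans szC (leq_trans _ (gP m)).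
  have leP : (size X).+1 * ((size X + (size X).+1) * (clause_bit_cost M + 10)) <=
      (X_bound m).+1 * ((X_bound m + (X_bound m).+1) * (clause_bit_cost m + 10)).
    apply: leq_mul => //; apply: leq_mul; first exact: leq_add.
    by rewrite leq_add2r clause_bit_cost_leq.
  rewrite /cost addn4 add1n !ltnS addnC; exact: leq_add leP (scan_cost_leq leMm).
move=> w; rewrite evalC /F outE.
case odd_m: (odd m) => /=.
  apply/esym/negbTE/negP => /asboolP[phi [_ _ wE]].
  have := size_tuple w; rewrite wE enc_cnfE size_bits_of mul2n => eqm.
  by rewrite -eqm odd_double in odd_m.
have szw : size w = 2 * M.
  by rewrite size_tuple -[LHS]odd_double_half odd_m mul2n.
case acc: (accepts M w) => /=; first exact: SATC3_clause_bits.
by apply/esym/negbTE/negP => /(SAT3_accepts szw); rewrite acc.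
Qed.

End Reduction.

Theorem theorem7 (alpha : nat -> nat -> {fset lit})
  (alphaP : is_enumeration alpha) :
  ~ P_IS (SATC3 alpha) <-> ~ P_poly SAT3.
Proof.
split=> not_P P; apply: not_P.
- exact: P_IS_of_P_poly alphaP P.
- exact: P_poly_of_P_IS alphaP P.
Qed.
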